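(* Let $d\geq 2$ and let $n\geq d+1$ be an integer. For integers $r\geq d+1$ let $\mathcal P_r$ be the class of compact convex polytopes in $[0,1]^d$ with positive volume and at most $r$ vertices, and let $\mathcal P_\infty$ be the class of all compact convex subsets of $[0,1]^d$ with positive volume. Given a sample $X_1,\ldots,X_n$ of i.i.d. random variables uniform on a set $P\in\mathcal P_\infty$, let, for each $r\in\{d+1,\ldots,n\}$, $\hat P_n^{(r)}\in\operatorname{argmin}\{|Q|: Q\in\mathcal P_r,\ X_i\in Q,\ i=1,\ldots,n\}$, and let $\hat K_n$ be the convex hull of the sample. Set $R_n=\lfloor n^{(d-1)/(d+1)}\rfloor$, fix a constant $C>16d+\frac{16}{d+1}$, and define $$\hat r=\min\Big\{r\in\{d+1,\ldots,n\} : |\hat P_n^{(r)}\triangle\hat P_n^{(r')}|\leq \frac{Cr'\ln n}{n}\ \ \forall r'\in\{r,\ldots,n\}\Big\},$$ and $\hat P_n^{adapt}=\hat P_n^{(\hat r)}$ if $\hat r\leq R_n$, $\hat P_n^{adapt}=\hat K_n$ otherwise. For integers $r\geq d+1$ and for $r=\infty$ let $\phi_{n,r}=\min\left(\frac{r\ln n}{n},(\ln n)\,n^{-\frac{2}{d+1}}\right)$ (with $\phi_{n,\infty}=(\ln n)n^{-2/(d+1)}$). Then there is a constant $c(d)>0$ depending only on $d$ (and the choice of $C$) such that $$\sup_{d+1\leq r\leq\infty}\ \sup_{P\in\mathcal P_r}\mathbb E_P\left[\phi_{n,r}^{-1}\,|\hat P_n^{adapt}\triangle P|\right]\leq c(d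).$$
   Context: $|\cdot|$ is Lebesgue measure, $\triangle$ symmetric difference, $\lfloor\cdot\rfloor$ the integer part, and $\mathbb E_P$ expectation (outer if needed) when $X_1,\ldots,X_n$ are i.i.d. uniform on $P$. The minimal-volume polytopes $\hat P_n^{(r)}$ need not be unique; any choice may be made. *)

(* Defs.v *)
From HB Require Import structures.
From mathcomp Require Import all_boot all_order all_algebra.
From mathcomp Require Import all_classical all_reals all_analysis.
Set Implicit Arguments. Unset Strict Implicit. Unset Printing Implicit Defensive.
Import Order.TTheory GRing.Theory Num.Theory.
Import numFieldNormedType.Exports.
Local Open Scope classical_set_scope.
Local Open Scope ring_scope.

Section Defs.
Variable R : realType.

Definition box (k : nat) (ab : 'rV[R]_k * 'rV[R]_k) : set 'rV[R]_k :=
  [set x | forall i, ab.1 0 i <= x 0 i <= ab.2 0 i].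
Definition box_vol (k : nat) (ab : 'rV[R]_k * 'rV[R]_k) : R :=
  \prod_(i < k) Num.max 0 (ab.2 0 i - ab.1 0 i).

(** Lebesgue (outer) measure on R^k, defined by countable covers by boxes.
    It coincides with Lebesgue measure on Lebesgue-measurable sets. *)
Definition leb (k : nat) (A : set 'rV[R]_k) : \bar R :=
  ereal_inf [set s : \bar R | exists B : nat -> 'rV[R]_k * 'rV[R]_k,
      A `<=` \bigcup_j box (B j) /\
      s = (\sum_(0 <= j <oo) (box_vol (B j))%:E)%E].

Definition symdiff (T : Type) (A B : set T) : set T := (A `\` B) `|` (B `\` A).

Definition unit_cube (d : nat) : set 'rV[R]_d :=
  [set x | forall i, 0 <= x 0 i <= 1].

Definition conv_hull (d : nat) (A : set 'rV[R]_d) : set 'rV[R]_d :=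
  [set x | exists (m : nat) (w : 'I_m -> R) (p : 'I_m -> 'rV[R]_d),
      (forall i, 0 <= w i) /\ \sum_(i < m) w i = 1 /\
      (forall i, A (p i)) /\ x = \sum_(i < m) w i *: p i].

Definition Pclass (d : nat) (r : option nat) (Q : set 'rV[R]_d) : Prop :=
  [/\ Q `<=` @unit_cube d, (0 < leb Q)%E &
    match r with
    | Some r => exists s : seq 'rV[R]_d,
        (size s <= r)%N /\ Q = conv_hull [set x | x \in s]
    | None => compact Q /\ convex_set (Q : set (convex_lmodType 'rV[R]_d))
    end].

Definition is_min_poly (d n r : nat) (X : 'I_n -> 'rV[R]_d)
    (P' : set 'rV[R]_d) : Prop :=
  [/\ Pclass (Some r) P', (forall i, P' (X i)) &
      forall Q, Pclass (Some r) Q -> (forall i, Q (X i)) -> (leb P' <= leb Q)%E].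

(** Admissible choice of the estimators \hat P_n^{(r)}, d+1 <= r <= n :
    whenever the argmin is nonempty, the selected set belongs to it
    (any choice otherwise, which only happens on a null set). *)
Definition estimator_choice (d n : nat)
    (Phat : nat -> ('I_n -> 'rV[R]_d) -> set 'rV[R]_d) : Prop :=
  forall r X, (d < r <= n)%N ->
    (exists P', is_min_poly r X P') -> is_min_poly r X (Phat r X).

Definition rhat (d n : nat) (C : R)
    (Phat : nat -> ('I_n -> 'rV[R]_d) -> set 'rV[R]_d) (X : 'I_n -> 'rV[R]_d) : nat :=
  head n [seq r <- iota d.+1 (n - d) |
    `[< forall r', (r <= r' <= n)%N ->
          (leb (symdiff (Phat r X) (Phat r' X))
             <= (C * r'%:R * ln (n%:R) / n%:R)%:E)%E >]].

Definition Rn (d n : nat) : int :=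
  Num.floor (powR (n%:R : R) ((d.-1)%:R / (d.+1)%:R)).

Definition Padapt (d n : nat) (C : R)
    (Phat : nat -> ('I_n -> 'rV[R]_d) -> set 'rV[R]_d) (X : 'I_n -> 'rV[R]_d)
    : set 'rV[R]_d :=
  if ((rhat C Phat X)%:Z <= Rn d n)%R then Phat (rhat C Phat X) X
  else conv_hull (range X).

Definition phi (d n : nat) (r : option nat) : R :=
  let rate := ln (n%:R) * powR (n%:R) (- (2%:R / (d.+1)%:R)) in
  match r with
  | Some r => Num.min (r%:R * ln (n%:R) / n%:R) rate
  | None => rate
  end.

Definition sample_of (d n : nat) (z : 'rV[R]_(n * d + 1)) : 'I_n -> 'rV[R]_d :=
  fun i => row i (vec_mx (lsubmx z)).
Definition height_of (d n : nat) (z : 'rV[R]_(n * d + 1)) : R := rsubmx z 0 0.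

(** Outer expectation E*_P[Z(X_1..X_n)] of a nonnegative functional Z, where
    X_1..X_n are i.i.d. uniform on P: the (outer) Lebesgue measure of the
    subgraph of Z over P^n, divided by |P|^n. *)
Definition outer_expect (d n : nat) (P : set 'rV[R]_d)
    (Z : ('I_n -> 'rV[R]_d) -> \bar R) : \bar R :=
  (leb [set z : 'rV[R]_(n * d + 1) |
          (forall i, P (sample_of z i)) /\ (0 <= height_of z)%R /\
          ((height_of z)%:E < Z (sample_of z))%E]
   * ((fine (leb P)) ^- n)%:E)%E.

End Defs.
Arguments phi {R} d n r.
Arguments Rn {R} d n.

(* Main.v *)
(* With probability at least 1 - O(n^-3), every polytope with at most r <= n vertices
   in the cube that contains the sample misses at most k r ln n / n of the volume of P,
   where k = C / 4: this follows from a union bound over polytopes with vertices on a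
   grid of mesh 1/n, because a convex body in the cube gains only O(t) volume when it
   is thickened by t.  On this event, if P is a polytope with r vertices, then
   minimality gives |Phat_r' \ P| <= |P \ Phat_r'| for r' >= r, so r is admissible in
   the definition of rhat and rhat <= r; otherwise P and the hull of the sample are
   enclosed, inside the cube, in polytopes with O(m^(d-1)) vertices and excess volume
   O(m^-2), where m is of order n^(1/(d+1)) (Dudley).  The exceptional event is
   absorbed by the crude bound C ln n + 1 on the loss.  A minimizer exists as soon as
   the hull of the sample has positive volume, hence almost surely. *)

Require Import Defs.
From HB Require Import structures.
From mathcomp Require Import all_boot all_order all_algebra.
From mathcomp Require Import all_classical all_reals all_analysis.
From mathcomp Require Import ring lra zify.
Import Order.TTheory GRing.Theory Num.Theory.
Import numFieldNormedType.Exports.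
Set Implicit Arguments. Unset Strict Implicit. Unset Printing Implicit Defensive.
Local Open Scope classical_set_scope.
Local Open Scope ring_scope.

(** * Lebesgue outer measure *)

Section Lebesgue.
Variables (R : realType) (k : nat).
Implicit Types (A B : set 'rV[R]_k).

(** [leb] is an outer measure and the expectation is the outer measure of a subgraph in dimension nd
    + 1, so no event has to be measurable: probabilities are bounded by subadditivity, and
    independence enters as a bound on the outer measure of A^n x [0, a] obtained from box covers.
    Additivity is used only to split a set along a closed one. The quarter in k = C / 4: a symmetric
    difference with P costs two misses, and comparing two estimators through P costs four. The grid
    carries at most n^(2rd) vertex configurations, each containing the sample with probability
    O(n^(-kr)), so k >= 2d + 4 leaves n^-4 for each r. Since phi >= ln n / n, the normalised loss is
    at most (C + 2) n on the exceptional event, and n * n^-4 * n stays bounded. Competitors of the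
    minimizers must lie inside the cube. Hence an inner approximation of a convex body cannot simply
    be enlarged, and coordinates close to a face of the cube need a separate treatment. *)

Lemma box_vol_ge0 (ab : 'rV[R]_k * 'rV[R]_k) : 0 <= box_vol ab.
Proof. by apply: prodr_ge0 => i _; rewrite le_max lexx. Qed.

Lemma leb_ge0 A : (0 <= leb A)%E.
Proof.
apply: le_ereal_inf_tmp => s [B [_ ->]].
by apply: nneseries_ge0 => j _ _; rewrite lee_fin box_vol_ge0.
Qed.

Lemma leb_le_cover A (B : nat -> 'rV[R]_k * 'rV[R]_k) :
  A `<=` \bigcup_j box (B j) ->
  (leb A <= \sum_(0 <= j <oo) (box_vol (B j))%:E)%E.
Proof. by move=> AB; apply: ereal_inf_lbound; exists B. Qed.

Lemma leb_lt_cover A (x : \bar R) : (leb A < x)%E ->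
  exists B : nat -> 'rV[R]_k * 'rV[R]_k, A `<=` \bigcup_j box (B j) /\
    (\sum_(0 <= j <oo) (box_vol (B j))%:E < x)%E.
Proof. by move=> /ereal_inf_lt[s [B [AB ->]] sx]; exists B. Qed.

Lemma le_leb A B : A `<=` B -> (leb A <= leb B)%E.
Proof.
move=> AB; apply: le_ereal_inf_tmp => s [C [BC ->]].
by apply: leb_le_cover; apply: subset_trans BC.
Qed.

(** Covers that are optimal up to [e / 2^(n+1)], which exist once all measures are finite, are
    merged into one along a bijection of [nat] with [nat * nat]. *)
Lemma leb_sigma_subadditive (F : nat -> set 'rV[R]_k) :
  (leb (\bigcup_n F n) <= \sum_(0 <= n <oo) leb (F n))%E.
Proof.
have [[i ioo]|] := pselect (exists i, leb (F i) = +oo%E).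
  rewrite (eseries_pinfty _ _ ioo) ?leey// => n _.
  by rewrite -ltNye (lt_le_trans _ (leb_ge0 _)).
rewrite -forallNE => Foo.
suff add2e (e : {posnum R}) :
    (leb (\bigcup_n F n) <= \sum_(0 <= n <oo) leb (F n) + e%:num%:E)%E.
  by apply/lee_addgt0Pr => _/posnumP[].
rewrite (le_trans _ (epsilon_trick _ _ _))//; last first.
  by move=> n; exact: leb_ge0.
pose P n (B : nat -> 'rV[R]_k * 'rV[R]_k) := F n `<=` \bigcup_j box (B j) /\
  (\sum_(0 <= j <oo) (box_vol (B j))%:E
     <= leb (F n) + (e%:num / (2 ^ n.+1)%:R)%:E)%E.
have [G PG] : {G : nat -> nat -> 'rV[R]_k * 'rV[R]_k & forall n, P n (G n)}.
  apply: (@choice _ _ P) => n.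
  have : (leb (F n) < leb (F n) + (e%:num / (2 ^ n.+1)%:R)%:E)%E.
    have Ffin : leb (F n) \is a fin_num.
      by rewrite ge0_fin_numE ?leb_ge0// ltey; apply/eqP/Foo.
    by rewrite lteDl// lte_fin divr_gt0.
  by move=> /leb_lt_cover[B [FB sB]]; exists B; split => //; exact: ltW.
pose vol (p : nat * nat) : \bar R := (box_vol (G p.1 p.2))%:E.
have vol0 p : (0 <= vol p)%E by rewrite lee_fin box_vol_ge0.
apply: (@le_trans _ _ (\esum_(i in setT) vol i)%E).
  have /card_esym/ppcard_eqP[f] := card_nat2.
  apply: (@le_trans _ _ (\sum_(0 <= j <oo) vol (f j))%E).
    apply: leb_le_cover => x [n _ /(PG n).1[j _ Bx]].
    exists (f^-1%FUN (n, j)) => //=.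
    by rewrite invK ?inE.
  rewrite -(esum_pred_image vol f xpredT) ?[fun=> _]set_true//.
  by rewrite image_eq.
rewrite (_ : esum _ _ = \sum_(i <oo) \sum_(j <oo) vol (i, j))%E; last first.
  pose J : nat -> set (nat * nat) := fun i => [set (i, j) | j in setT].
  rewrite (_ : setT = \bigcup_k J k); last first.
    by rewrite predeqE => -[a b]; split => // _; exists a => //; exists b.
  rewrite esum_bigcupT /=; last 2 first.
  - apply/trivIsetP => i j _ _ ij.
    rewrite predeqE => -[n m] /=; split => //= -[] [_] _ [<-{n} _].
    by move=> [m' _] [] /esym/eqP; rewrite (negbTE ij).
  - by move=> /= p; exact: vol0.
  rewrite -(image_id [set: nat]) -fun_true esum_pred_image//; last first.
    by move=> n _; exact: esum_ge0.
  apply: eq_eseriesr => /= j _.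
  rewrite -(esum_pred_image vol (pair j) predT)//=; last first.
    by move=> ? ? _ _; exact: (@can_inj _ _ _ snd).
  by congr esum; rewrite predeqE => -[a b]; split; move=> [i _ <-]; exists i.
apply: lee_nneseries => [n *|n *]; first exact: nneseries_ge0.
exact: (PG n).2.
Qed.

(* In dimension 0 the empty product gives every box volume 1, so that the measure
   of the empty set is +oo. *)
Lemma leb0 : (0 < k)%N -> leb (set0 : set 'rV[R]_k) = 0.
Proof.
move=> k0; apply/eqP; rewrite eq_le leb_ge0 andbT.
apply: (le_trans (@leb_le_cover _ (fun=> (0, const_mx (- 1))) (@sub0set _ _))).
rewrite eseries0// => j _ _; rewrite /box_vol (bigD1 (Ordinal k0))//= !mxE.
by rewrite max_l ?mul0r// subr0 lerN10.
Qed.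

Lemma leb_box (ab : 'rV[R]_k * 'rV[R]_k) : (0 < k)%N ->
  (leb (box ab) <= (box_vol ab)%:E)%E.
Proof.
(* The one-box cover is completed by empty boxes, of volume 0 because [k] is positive. *)
move=> k0; pose B (j : nat) : 'rV[R]_k * 'rV[R]_k :=
  if j is 0%N then ab else (0, const_mx (- 1)).
have cB : box ab `<=` \bigcup_j box (B j) by move=> x bx; exists 0%N.
apply: (le_trans (leb_le_cover cB)).
rewrite nneseries_recl//; last by move=> n; rewrite lee_fin box_vol_ge0.
rewrite eseries_cond eseries0 ?adde0// => -[|j]// _ _.
rewrite /box_vol (bigD1 (Ordinal k0))//= !mxE.
by rewrite max_l ?mul0r// subr0 lerN10.
Qed.

End Lebesgue.

HB.instance Definition _ (R : realType) (k : nat) :=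
  isOuterMeasure.Build R 'rV[R]_k.+1 (@leb R k.+1)
    (leb0 R (ltn0Sn k)) (@leb_ge0 R k.+1) (@le_leb R k.+1)
    (@leb_sigma_subadditive R k.+1).

Section LebesgueTheory.
Variables (R : realType) (k : nat).
Hypothesis k0 : (0 < k)%N.
Implicit Types (A B : set 'rV[R]_k).

Lemma lebU A B : (leb (A `|` B) <= leb A + leb B)%E.
Proof. by case: k k0 A B => // k' _ A B; exact: outer_measureU2. Qed.

Lemma leb_fin_bigcup (I : finType) (F : I -> set 'rV[R]_k) :
  (leb (\bigcup_i F i) <= \sum_i leb (F i))%E.
Proof.
have -> : \bigcup_i F i = \big[setU/set0]_(i in I) F i.
  apply/seteqP; split => x.
    by move=> [i _ Fx]; rewrite (bigD1 i)//=; left.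
  by elim/big_ind : _ => //[A B IA IB [/IA|/IB]//|i _ Fx]; exists i.
elim/big_ind2 : _ => [|A a B b Aa Bb|//]; first by rewrite leb0.
by rewrite (le_trans (lebU _ _))// leeD.
Qed.

End LebesgueTheory.

(** * Topology of row vectors in coordinates *)

Section ClosedSets.
Variables (R : realType) (k : nat).
Implicit Types (A : set 'rV[R]_k).

(** Neighbourhoods are closed sup-norm balls written coordinatewise, the shape in which all later
    approximations are stated. *)
Lemma open_coordP A : open A <-> forall x, A x ->
  exists2 e : R, 0 < e & forall y : 'rV[R]_k, (forall i, `|y 0 i - x 0 i| <= e) -> A y.
Proof.
split.
  move=> oA x Ax; have /nbhs_ballP[e /= e0 eA] : nbhs x A by exact: open_nbhs_nbhs.
  exists (e / 2) => [|y yx]; first by rewrite divr_gt0.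
  apply: eA; split=> // i j; rewrite /ball/= (ord1 i) distrC.
  by rewrite (le_lt_trans (yx j))// ltr_pdivrMr// ltr_pMr// ltr1n.
move=> H; rewrite openE => x /H[e e0 eA].
apply/nbhs_ballP; exists e => //= y [_ yx]; apply: eA => i.
by rewrite distrC; exact/ltW/yx.
Qed.

Lemma closed_coordP A : closed A <-> forall x, ~ A x ->
  exists2 e : R, 0 < e & forall y : 'rV[R]_k, (forall i, `|y 0 i - x 0 i| <= e) -> ~ A y.
Proof. by rewrite -openC; exact: open_coordP. Qed.

Lemma closed_coord_limit A (x : 'rV[R]_k) : closed A ->
  (forall e : R, 0 < e -> exists2 y, A y & forall i, `|y 0 i - x 0 i| <= e) -> A x.
Proof.
move=> /closed_coordP cA H; apply: contrapT => /cA[e e0 He].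
by have [y Ay /He] := H _ e0.
Qed.

Lemma compact_coord_bounded A (M : R) : closed A ->
  (forall x, A x -> forall i, `|x 0 i| <= M) -> compact A.
Proof.
move=> cA AM; apply: bounded_closed_compact => //.
exists `|M|; split; first exact: normr_real.
move=> N MN x Ax /=; rewrite /Num.norm/= mx_normrE; apply/bigmax_leP; split.
  by rewrite (le_trans _ (ltW MN)).
move=> [i j] _ /=; rewrite (ord1 i) (le_trans (AM _ Ax j))//.
by rewrite (le_trans (ler_norm _))// ltW.
Qed.

Lemma rat_approx (x : 'rV[R]_k) (e : R) : 0 < e ->
  exists q : 'rV[rat]_k, forall i, `|ratr (q 0 i) - x 0 i| <= e.
Proof.
move=> e0; have /fin_all_exists[q Hq] (i : 'I_k) :
    exists q : rat, `|ratr q - x 0 i| <= e.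
  have [|q] := @rat_in_itvoo R (x 0 i - e) (x 0 i + e); first by lra.
  rewrite in_itv/= => /andP[? ?]; exists q.
  by rewrite ler_norml; apply/andP; split; lra.
by exists (\row_i q i) => i; rewrite mxE.
Qed.

End ClosedSets.

(** * Caratheodory measurability of closed sets and translation invariance *)

Section Caratheodory.
Variables (R : realType) (k : nat).
Local Notation V := 'rV[R]_k.+1.
Local Notation M := (caratheodory_measurable (@leb R k.+1)).

(** No position of [c] is excluded: if it misses the side [i], one half has a reversed side and
    volume 0 thanks to the [Num.max 0] in [box_vol]. *)
Lemma box_vol_split (l h l' h' : V) (i : 'I_k.+1) (c : R) :
  h' = \row_j (if j == i then Num.min (h 0 j) c else h 0 j) ->
  l' = \row_j (if j == i then Num.max (l 0 j) c else l 0 j) ->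
  box_vol (l, h') + box_vol (l', h) = box_vol (l, h).
Proof.
move=> -> ->; rewrite /box_vol/= !(bigD1 (P := xpredT) i)//= !mxE eqxx.
under eq_bigr => j ji do rewrite mxE (negbTE ji).
under [X in _ + _ * X]eq_bigr => j ji do rewrite mxE (negbTE ji).
rewrite -mulrDl; congr (_ * _).
case: (leP (h 0 i) c) => ?; case: (leP (l 0 i) c) => ?;
 case: leP => ?; try case: leP => ?; try case: leP => ?; lra.
Qed.

(** Cutting each box of a cover of [X] at height [c] yields covers of the two parts of [X] with the
    same total volume. *)
Lemma halfspace_caratheodory (i : 'I_k.+1) (c : R) : M [set x : V | x 0 i <= c].
Proof.
apply: le_caratheodory_measurable => X.
set H := [set x | _].
apply: le_ereal_inf_tmp => s [B [XB ->]].
pose h' j : V := \row_m (if m == i then Num.min ((B j).2 0 m) c else (B j).2 0 m).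
pose l' j : V := \row_m (if m == i then Num.max ((B j).1 0 m) c else (B j).1 0 m).
rewrite (eq_eseriesr (g := fun j => (box_vol ((B j).1, h' j))%:E +
    (box_vol (l' j, (B j).2))%:E)%E); last first.
  by move=> j _; rewrite -EFinD (box_vol_split (i := i) (c := c)) -?surjective_pairing.
rewrite nneseriesD; try by move=> *; rewrite lee_fin box_vol_ge0.
apply: leeD; apply: leb_le_cover => x [/XB[j _ Bx] Hx]; exists j => // m;
  have /andP[Bl Bh] := Bx m; rewrite /= mxE; case: eqP => [mi|_];
  rewrite ?Bl ?Bh// ?andbT ?andTb.
- by rewrite le_min Bh mi.
- by rewrite ge_max Bl mi/=; apply/ltW; rewrite ltNge; apply/negP.
Qed.

Lemma box_caratheodory (ab : V * V) : M (box ab).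
Proof.
have -> : box ab = \big[setI/setT]_(i < k.+1)
   ([set x : V | x 0 i <= ab.2 0 i] `&` [set x : V | ab.1 0 i <= x 0 i]).
  rewrite -bigcap_seq; apply/seteqP; split => x /=.
    by move=> bx i _; have /andP[] := bx i.
  by move=> bx i; apply/andP; have [] := bx i (mem_index_enum i).
have step (i : 'I_k.+1) : M [set x : V | ab.1 0 i <= x 0 i].
  have -> : [set x : V | ab.1 0 i <= x 0 i] =
      \bigcap_(n : nat) (~` [set x | x 0 i <= ab.1 0 i - n.+1%:R^-1]).
    apply/seteqP; split => x /=.
      move=> ax n _ /=; apply/negP; rewrite -ltNge (lt_le_trans _ ax)//.
      by rewrite ltrBlDr ltrDl invr_gt0.
    move=> H; apply/ler_addgt0Pl => e e0.
    have [n ne] := ltr_add_invr (y := 0) (x := e) e0.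
    rewrite add0r in ne; have /negP := H n I; rewrite -ltNge => Hn.
    by rewrite -lerBlDl ltW// (lt_trans _ Hn)// ltrD2l ltrN2.
  rewrite -(setCK (bigcap _ _)) setC_bigcap; apply: caratheodory_measurable_setC.
  apply: caratheodory_measurable_bigcup => n; rewrite setCK.
  exact: halfspace_caratheodory.
elim/big_ind : _ => [|A B|i _].
- by rewrite -setC0; exact/caratheodory_measurable_setC/caratheodory_measurable_set0.
- exact: caratheodory_measurable_setI.
- by apply: caratheodory_measurable_setI; [exact: halfspace_caratheodory|].
Qed.

(** An open set is the union of the countably many cubes with rational centre and half-side 1/(m+1)
    that it contains. *)
Lemma open_caratheodory (A : set V) : open A -> M A.
Proof.
move=> oA.
pose b (p : 'rV[rat]_k.+1 * nat) : V * V :=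
  (\row_i (ratr (p.1 0 i) - p.2.+1%:R^-1), \row_i (ratr (p.1 0 i) + p.2.+1%:R^-1)).
pose F n : set V := if unpickle n is Some p then
  (if `[< box (b p) `<=` A >] then box (b p) else set0) else set0.
have -> : A = \bigcup_n F n.
  apply/seteqP; split => x; last first.
    move=> [n _]; rewrite /F; case: unpickle => // p.
    by case: asboolP => // bA; exact: bA.
  move=> /(open_coordP A).1 - /(_ oA)[e e0 eA].
  have [m me] := ltr_add_invr (y := 0) (x := e / 2) (divr_gt0 e0 (ltr0n _ 2)).
  rewrite add0r in me.
  have m0 : 0 < m.+1%:R^-1 :> R by rewrite invr_gt0.
  have [q Hq] := rat_approx x m0.
  exists (pickle (q, m)) => //; rewrite /F pickleK.
  case: asboolP => [_ i|[]] /=.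
    rewrite !mxE; have := Hq i; rewrite ler_norml.
    by move: (ratr _) (_ ^-1) => a c /andP[? ?]; apply/andP; split; lra.
  move=> y by_; apply: eA => i; have := Hq i; have := by_ i.
  rewrite /= !mxE !ler_norml; move: (ratr _) me => a; move: (_ ^-1) => c me.
  by move=> /andP[? ?] /andP[? ?]; apply/andP; split; lra.
apply: caratheodory_measurable_bigcup => n; rewrite /F.
case: unpickle => [p|]; last exact: caratheodory_measurable_set0.
by case: ifP => _; [exact: box_caratheodory|exact: caratheodory_measurable_set0].
Qed.

Lemma closed_caratheodory (A : set V) : closed A -> M A.
Proof.
by rewrite -openC -{2}(setCK A) => /open_caratheodory; exact: caratheodory_measurable_setC.
Qed.

(** [X] is arbitrary; this matters in [misses_mass_net], where the support is only known to lie in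
    the cube. *)
Lemma leb_closed_split (A X : set V) : closed A ->
  leb X = (leb (X `&` A) + leb (X `\` A))%E.
Proof. by move=> /closed_caratheodory/(_ X); rewrite setDE. Qed.

Lemma leb_shift (v : V) (A : set V) : leb [set x + v | x in A] = leb A.
Proof.
suff H (w : V) (B : set V) : (leb [set (x + w)%R | x in B] <= leb B)%E.
  apply/eqP; rewrite eq_le H/= (le_trans _ (H (- v) _))//; apply: le_leb => x Ax.
  by exists (x + v); [exists x|rewrite addrK].
apply: le_ereal_inf_tmp => s [C [BC ->]].
pose C' j : V * V := ((C j).1 + w, (C j).2 + w).
rewrite (eq_eseriesr (g := fun j => (box_vol (C' j))%:E)%E); last first.
  move=> j _; rewrite /box_vol; congr (_%:E); apply: eq_bigr => i _.
  by rewrite !mxE; congr (Num.max _ _); ring.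
apply: leb_le_cover => _ [x /BC[j _ Cx] <-]; exists j => // i.
by have := Cx i; rewrite !mxE !lerD2r.
Qed.

End Caratheodory.

(** * Outer measure of product sets in the space of samples *)

Section SampleProduct.
Variables (R : realType) (n d : nat).
Local Notation V := 'rV[R]_d.

Lemma leb_sample_boxes (f : 'I_n -> V * V) (a : R) : 0 <= a ->
  (leb [set z : 'rV[R]_(n * d + 1) |
     (forall i, box (f i) (sample_of z i)) /\ (0 <= height_of z <= a)%R]
   <= ((\prod_(i < n) box_vol (f i)) * a)%:E)%E.
Proof.
move=> a0.
pose F : 'rV[R]_(n * d + 1) * 'rV[R]_(n * d + 1) :=
  (row_mx (mxvec (\matrix_i (f i).1)) (const_mx 0),
   row_mx (mxvec (\matrix_i (f i).2)) (const_mx a)).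
have -> : (\prod_(i < n) box_vol (f i)) * a = box_vol F.
  rewrite /box_vol big_split_ord/= big_ord1 !row_mxEr !mxE subr0 (max_r a0).
  congr (_ * _); rewrite pair_bigA/=.
  rewrite (reindex (uncurry (@mxvec_index n d)))/=; last first.
    exact: curry_mxvec_bij.
  by apply: eq_bigr => -[i j] _ /=; rewrite !row_mxEl !mxvecE !mxE.
apply: le_trans (leb_box _ _); last by rewrite addn1.
apply: le_leb => z [bz hz] l /=.
case: (split_ordP l) => l' ->{l}; last first.
  by rewrite !row_mxEr !mxE; move: hz; rewrite /height_of mxE (ord1 l').
rewrite !row_mxEl; case/mxvec_indexP: l' => i j; rewrite !mxvecE !mxE.
by have := bz i j; rewrite /sample_of !mxE.
Qed.

(** Stands in for Fubini's theorem. The strict inequality provides one cover of total volume below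
    [s], which serves for every factor. *)
Lemma leb_sample_lt (A : set V) (s a : R) : 0 <= a -> (leb A < s%:E)%E ->
  (leb [set z : 'rV[R]_(n * d + 1) |
     (forall i, A (sample_of z i)) /\ (0 <= height_of z <= a)%R]
   <= (s ^+ n * a)%:E)%E.
Proof.
move=> a0 /leb_lt_cover[B [AB Bs]].
have s0 : 0 <= s.
  rewrite -lee_fin (le_trans _ (ltW Bs))//.
  by apply: nneseries_ge0 => *; rewrite lee_fin box_vol_ge0.
(* The factors of the product are replaced by boxes one at a time. *)
suff H m : (m <= n)%N -> forall f : 'I_n -> V * V,
  (leb [set z : 'rV[R]_(n * d + 1) |
     (forall i : 'I_n, if (i < n - m)%N then box (f i) (sample_of z i)
                       else A (sample_of z i)) /\ (0 <= height_of z <= a)%R]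
   <= (\prod_(i < n) (if (i < n - m)%N then box_vol (f i) else s) * a)%:E)%E.
  have := H n (leqnn n) (fun=> (0, 0)); rewrite subnn/= prodr_const card_ord.
  by apply: le_trans; apply: le_leb.
elim: m => [_ f|m IH mn f].
  rewrite subn0 (eq_bigr (fun i => box_vol (f i))); last by move=> i _; rewrite ltn_ord.
  apply: le_trans (leb_sample_boxes _ a0); apply: le_leb => z [Hz hz].
  by split => // i; have := Hz i; rewrite ltn_ord.
have kn : (n - m.+1 < n)%N by rewrite ltn_subrL (leq_ltn_trans _ mn).
pose io := Ordinal kn.
pose f' j : 'I_n -> V * V := fun i => if i == io then B j else f i.
pose C := \prod_(i < n | i != io) (if (i < n - m.+1)%N then box_vol (f i) else s).
have C0 : 0 <= C by apply: prodr_ge0 => i _; case: ifP => // _; exact: box_vol_ge0.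
have lti (i : 'I_n) : i != io -> (i < n - m)%N = (i < n - m.+1)%N.
  by rewrite -val_eqE /= => iio; lia.
have ltio : (io < n - m)%N by rewrite /=; lia.
have ltioF : (io < n - m.+1)%N = false by rewrite ltnn.
rewrite (bigD1 io)//= ltnn -/C.
apply: (@le_trans _ _ (\sum_(0 <= j <oo) ((C * a)%:E * (box_vol (B j))%:E))%E).
  apply: (@le_trans _ _ (\sum_(0 <= j <oo) leb [set z : 'rV[R]_(n * d + 1) |
     (forall i : 'I_n, if (i < n - m)%N then box (f' j i) (sample_of z i)
                       else A (sample_of z i)) /\ (0 <= height_of z <= a)%R])%E).
    apply: le_trans (leb_sigma_subadditive _); apply: le_leb => z [Hz hz].
    have /AB[j _ Bj] : A (sample_of z io) by have := Hz io; rewrite ltioF.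
    exists j => //; split => // i; rewrite /f'; have [->|iio] := eqVneq i io.
      by rewrite ltio.
    by rewrite lti//; exact: Hz.
  apply: lee_nneseries => [j *|j *]; first exact: leb_ge0.
  rewrite (le_trans (IH (ltnW mn) _))// (bigD1 io)//= ltio /f' eqxx.
  rewrite (eq_bigr (fun i : 'I_n => if (i < n - m.+1)%N then box_vol (f i) else s)).
    by rewrite -/C -EFinM lee_fin -mulrA mulrC.
  by move=> i iio; rewrite lti// (negbTE iio).
rewrite nneseriesZl; last by move=> *; rewrite lee_fin box_vol_ge0.
have -> : s * C * a = C * a * s by ring.
rewrite [in leRHS]EFinM; apply: lee_wpmul2l; last exact: ltW.
by rewrite lee_fin mulr_ge0.
Qed.

(** The infimum over covers need not be attained, hence a limit [s -> l] from the right. *)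
Lemma leb_sample_le (A : set V) (a l : R) : 0 <= a -> (leb A <= l%:E)%E ->
  (leb [set z : 'rV[R]_(n * d + 1) |
     (forall i, A (sample_of z i)) /\ (0 <= height_of z <= a)%R]
   <= (l ^+ n * a)%:E)%E.
Proof.
move=> a0 Al; set L := leb _.
have Ls s : l < s -> (L <= (s ^+ n * a)%:E)%E.
  by move=> ls; apply: leb_sample_lt => //; rewrite (le_lt_trans Al)// lte_fin.
have Lfin : L \is a fin_num.
  rewrite ge0_fin_numE ?leb_ge0// (le_lt_trans (Ls (l + 1) _)) ?ltry//.
  by rewrite ltrDl.
rewrite -(fineK Lfin) lee_fin.
have cvf : s ^+ n * a @[s --> l^'+] --> l ^+ n * a.
  apply: cvgM; last exact: cvg_cst.
  by apply: cvg_at_right_filter; exact: exprn_continuous.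
rewrite -(cvg_lim _ cvf)//; apply: limr_ge; first by apply/cvg_ex; eexists; exact: cvf.
near=> s; rewrite -lee_fin fineK//; apply: Ls.
by near: s; exact: nbhs_right_gt.
Unshelve. all: by end_near. Qed.

End SampleProduct.

(** * Volume of thin neighbourhoods of convex bodies *)

Definition convex_rV (R : realType) (k : nat) (A : set 'rV[R]_k) :=
  forall x y (t : R), A x -> A y -> 0 <= t <= 1 -> A (t *: x + (1 - t) *: y).

(** Enlargement in the sup norm, i.e. the Minkowski sum with a cube: it can be produced by sweeping
    along the coordinate axes one after the other. *)
Definition thicken (R : realType) (k : nat) (A : set 'rV[R]_k) (t : R) : set 'rV[R]_k :=
  [set y : 'rV[R]_k | exists2 x : 'rV[R]_k, A x & forall i, `|y 0 i - x 0 i| <= t].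

Section Thickening.
Variables (R : realType) (k : nat).
Local Notation V := 'rV[R]_k.+1.
Implicit Types (A B : set V) (v : V).

Definition minkowski A B : set V := [set x + y | x in A & y in B].

Definition segment_to v (N : R) : set V :=
  [set x | exists2 s : R, 0 <= s <= N & s *: v = x].

Lemma box_closed (ab : V * V) : closed (box ab).
Proof.
apply/closed_coordP => x /existsNP[i] /negP; rewrite negb_and -!ltNge => /orP[]h.
  exists ((ab.1 0 i - x 0 i) / 2); first by rewrite divr_gt0// subr_gt0.
  move=> y /(_ i) + /(_ i) /andP[+ _]; rewrite ler_norml => /andP[_ ? ?].
  by lra.
exists ((x 0 i - ab.2 0 i) / 2); first by rewrite divr_gt0// subr_gt0.
move=> y /(_ i) + /(_ i) /andP[_ +]; rewrite ler_norml => /andP[? _ ?].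
by lra.
Qed.

Lemma box_compact (ab : V * V) : compact (box ab).
Proof.
apply: (@compact_coord_bounded _ _ _ (\sum_i (`|ab.1 0 i| + `|ab.2 0 i|))).
  exact: box_closed.
move=> x bx i; rewrite (bigD1 i)//= (le_trans (y := `|ab.1 0 i| + `|ab.2 0 i|))//.
  have /andP[? ?] := bx i; rewrite ler_norml; apply/andP; split.
    by have := ler_norm (- ab.1 0 i); rewrite normrN; have := normr_ge0 (ab.2 0 i); lra.
  by have := ler_norm (ab.2 0 i); have := normr_ge0 (ab.1 0 i); lra.
by rewrite lerDl sumr_ge0// => j _; rewrite addr_ge0.
Qed.

Lemma box_convex (ab : V * V) : convex_rV (box ab).
Proof.
move=> x y t Ax Ay /andP[t0 t1] i; rewrite !mxE.
have /andP[? ?] := Ax i; have /andP[? ?] := Ay i; apply/andP; split; nra.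
Qed.

Lemma minkowski_compact A B : compact A -> compact B -> compact (minkowski A B).
Proof.
move=> cA cB.
have -> : minkowski A B = (fun p : V * V => p.1 + p.2) @` (A `*` B).
  apply/seteqP; split => [_ [x Ax [y By <-]]|_ [[x y] [/= Ax By] <-]].
    by exists (x, y).
  by exists x => //; exists y.
apply: continuous_compact; last exact: compact_setX.
apply: continuous_subspaceT => p.
by apply: cvgD; [exact: cvg_fst|exact: cvg_snd].
Qed.

Lemma minkowski_convex A B : convex_rV A -> convex_rV B -> convex_rV (minkowski A B).
Proof.
move=> cA cB _ _ t [a Aa [b Bb <-]] [a' Aa' [b' Bb' <-]] t01.
exists (t *: a + (1 - t) *: a'); first exact: cA.
exists (t *: b + (1 - t) *: b'); first exact: cB.
by rewrite !scalerDr addrACA.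
Qed.

Lemma segment_to_compact v N : compact (segment_to v N).
Proof.
have -> : segment_to v N = (fun s : R => s *: v) @` `[0, N].
  by apply/seteqP; split => x [s]; rewrite /= ?in_itv/= => h <-; exists s; rewrite /= ?in_itv.
apply: continuous_compact; last exact: segment_compact.
by apply: continuous_subspaceT => s; exact: scalel_continuous.
Qed.

Lemma segment_to_sub v (N N' : R) : N <= N' -> segment_to v N `<=` segment_to v N'.
Proof.
by move=> NN' _ [s /andP[s0 sN] <-]; exists s => //; rewrite s0 (le_trans sN).
Qed.

Lemma minkowski_subr A B B' : B `<=` B' -> minkowski A B `<=` minkowski A B'.
Proof. by move=> BB' _ [a Aa [b /BB' Bb <-]]; exists a => //; exists b. Qed.

Lemma compact_closed_rV A : compact A -> closed A.
Proof. by move=> kA; apply: compact_closed => //; exact: norm_hausdorff. Qed.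

(** Let x = q + s v be outside A. If x + N v were q' + s' v with q' in A and s' <= N, then q' = q +
    (s + N - s') v would lie on the ray from q at or beyond x, and convexity would put x in A. *)
Lemma sweep_translate A v (N : nat) : convex_rV A ->
  [set x + N%:R *: v | x in minkowski A (segment_to v 1) `\` A] `<=`
  minkowski A (segment_to v N.+1%:R) `\` minkowski A (segment_to v N%:R).
Proof.
move=> cA _ [_ [[q Aq [_ [s /andP[s0 s1] <-] <-]] nA] <-]; split.
  exists q => //; exists ((s + N%:R) *: v); last by rewrite scalerDl addrA.
  by exists (s + N%:R) => //; rewrite addr_ge0// -natr1 addrC lerD2l.
move=> [q' Aq' [_ [s' /andP[s'0 s'N] <-]]] E.
apply: nA.
have Eq' : q' = q + (s + N%:R - s') *: v.
  by apply: (addIr (s' *: v)); rewrite E -[RHS]addrA -scalerDl subrK scalerDl addrA.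
have [r0|r0] := leP (s + N%:R - s') 0.
  have -> : s = 0 by lra.
  by rewrite scale0r addr0.
pose t : R := 1 - s / (s + N%:R - s').
have r0' := lt0r_neq0 r0.
have -> : q + s *: v = t *: q + (1 - t) *: q'.
  rewrite Eq' scalerDr addrA -scalerDl scalerA.
  have -> : t + (1 - t) = 1 by rewrite addrC subrK.
  have -> : (1 - t) * (s + N%:R - s') = s by rewrite /t subKr divfK.
  by rewrite scale1r.
apply: cA => //; rewrite /t subr_ge0 ler_pdivrMr// mul1r gerBl.
by apply/andP; split; [lra|rewrite divr_ge0// ltW].
Qed.

(* The translates of the swept shell by multiples of [v] lie in the successive
   differences of the increasing sets A + [0, N] v. *)
Lemma leb_sweep_ge A v (N : nat) : compact A -> convex_rV A ->
  (N%:R%:E * leb (minkowski A (segment_to v 1%R) `\` A)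
     <= leb (minkowski A (segment_to v N%:R%R)))%E.
Proof.
move=> kA cA; elim: N => [|N IH]; first by rewrite mul0e leb_ge0.
rewrite -natr1 EFinD ge0_muleDl ?lee_fin// mul1e natr1.
set Q := minkowski A (segment_to v N%:R) in IH *.
have cQ : closed Q.
  by apply: compact_closed_rV; apply: minkowski_compact => //; exact: segment_to_compact.
rewrite (leb_closed_split (minkowski A (segment_to v N.+1%:R)) cQ); apply: leeD.
  apply: le_trans IH _; apply: le_leb => x Qx; split => //.
  by move: Qx; apply: minkowski_subr; apply: segment_to_sub; rewrite ler_nat.
rewrite -(leb_shift (N%:R *: v)); apply: le_leb.
exact: sweep_translate.
Qed.

Lemma leb_centered_box (b : R) : 0 <= b ->
  (leb [set x : V | forall i, (`|x 0 i| <= b)%R] <= ((2 * b) ^+ k.+1)%:E)%E.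
Proof.
move=> b0; have -> : [set x : V | forall i, `|x 0 i| <= b] =
    box (const_mx (- b), const_mx b).
  by apply/seteqP; split => x Hx i; have := Hx i; rewrite /= !mxE ler_norml.
apply: le_trans (leb_box _ _) _ => //; rewrite lee_fin /box_vol/=.
under eq_bigr => i _ do rewrite !mxE opprK max_r ?addr_ge0//.
by rewrite prodr_const card_ord (_ : b + b = 2 * b)//; ring.
Qed.

(** N = floor(1/t) disjoint translates of the shell fit into a displacement N t <= 1, hence into a
    cube of side 2(b + 1). As N >= 1/(2t), the shell has at most 2t times the volume of that
    cube. *)
Lemma leb_sweep_le A (j : 'I_k.+1) (b t e : R) : compact A -> convex_rV A ->
  0 <= b -> 0 < t <= 1 -> `|e| = t -> (forall x, A x -> forall i, `|x 0 i| <= b) ->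
  (leb (minkowski A (segment_to (e *: delta_mx 0 j)%R 1%R) `\` A)
     <= (2 * (2 * (b + 1)) ^+ k.+1 * t)%:E)%E.
Proof.
move=> kA cA b0 /andP[t0 t1] et Ab; set v := e *: _.
pose N := Num.truncn t^-1.
have tV1 : 1 <= t^-1 by rewrite invf_ge1.
have /andP[N1 N2] : N%:R <= t^-1 < N.+1%:R by apply: truncn_itv; rewrite ltW// invr_gt0.
have N0 : (0 < N)%N by rewrite truncn_gt0.
have NR : 1 <= N%:R :> R by rewrite ler1n.
have H := leb_sweep_ge v N kA cA.
have {H} : (N%:R%:E * leb (minkowski A (segment_to v 1%R) `\` A)
    <= ((2 * (b + 1)) ^+ k.+1)%:E)%E.
  apply: le_trans H _; apply: le_trans (leb_centered_box _); last by rewrite addr_ge0.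
  apply: le_leb => _ [a Aa [_ [s /andP[s0 sN] <-] <-]] i.
  rewrite !mxE eqxx/= (le_trans (ler_normD _ _))// lerD ?Ab// !normrM et ger0_norm//.
  rewrite (@le_trans _ _ (s * t))//.
    by rewrite ler_wpM2l// ler_piMr ?(ltW t0)//; case: (_ == _); rewrite ?normr1 ?normr0.
  by rewrite -ler_pdivlMr// mul1r (le_trans sN).
set L := leb _ => H.
have Lfin : L \is a fin_num.
  rewrite ge0_fin_numE ?leb_ge0// ltey; apply/eqP => L8; move: H.
  by rewrite L8 gt0_muley ?lte_fin ?ltr0n// leye_eq.
move: H; rewrite -(fineK Lfin) -EFinM !lee_fin => H.
have L0 : 0 <= fine L by rewrite fine_ge0 ?leb_ge0.
have tV : t * t^-1 = 1 by rewrite mulfV ?gt_eqF.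
have Nt : 1 <= 2 * (N%:R * t).
  have : t * t^-1 <= t * (2 * N%:R) by rewrite ler_pM2l//; rewrite -natr1 in N2; lra.
  by rewrite tV mulrCA (mulrC t).
nra.
Qed.

(** [T m] is [A] thickened in its first [m] coordinates. Each further coordinate costs two sweeps,
    by t and by -t, of a body bounded by b + 1; the 2(k + 1) sweeps give the constant. *)
Lemma leb_thicken_diff A (b t : R) : compact A -> convex_rV A -> 0 <= b -> 0 < t <= 1 ->
  (forall x, A x -> forall i, `|x 0 i| <= b) ->
  (leb (thicken A t `\` A)
     <= (4 * k.+1%:R * (2 * (b + 2)) ^+ k.+1 * t)%:E)%E.
Proof.
move=> kA cA b0 /andP[t0 t1] Ab.
pose tb m : V := \row_i (if (i < m)%N then t else 0).
pose T m := minkowski A (box (- tb m, tb m)).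
have kT m : compact (T m) by apply: minkowski_compact => //; exact: box_compact.
have cT m : convex_rV (T m) by apply: minkowski_convex => //; exact: box_convex.
have bT m x : T m x -> forall i, `|x 0 i| <= b + 1.
  move=> [a Aa [y By <-]] i; rewrite mxE (le_trans (ler_normD _ _))// lerD ?Ab//.
  have := By i; rewrite /= !mxE -ler_norml => /le_trans; apply.
  by case: ifP.
set c := 2 * (2 * (b + 2)) ^+ k.+1 * t.
have c0 : 0 <= c by rewrite !mulr_ge0 ?exprn_ge0 ?mulr_ge0 ?addr_ge0// ltW.
suff H m : (m <= k.+1)%N -> (leb (T m `\` A) <= (m%:R * (2 * c))%:E)%E.
  have := H k.+1 (leqnn _).
  rewrite (_ : k.+1%:R * (2 * c) = 4 * k.+1%:R * (2 * (b + 2)) ^+ k.+1 * t); last first.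
    by rewrite /c; ring.
  apply: le_trans; apply: le_leb; apply: setSD => x [a Aa xa].
  exists a => //; exists (x - a); last by rewrite addrC subrK.
  by move=> i; have := xa i; rewrite !mxE ltn_ord -ler_norml.
elim: m => [_|m IH mk].
  rewrite mul0r (_ : _ `\` _ = set0) ?leb0//; apply/seteqP; split => // x.
  move=> [[a Aa [y By <-]] []]; suff -> : y = 0 by rewrite addr0.
  apply/rowP => i; have := By i; rewrite /= !mxE/= oppr0 => h.
  by apply/eqP; rewrite eq_le andbC.
pose j : 'I_k.+1 := Ordinal mk.
pose E e := minkowski (T m) (segment_to (e *: delta_mx 0 j) 1) `\` T m.
have hE e : `|e| = t -> (leb (E e) <= c%:E)%E.
  move=> et; have := @leb_sweep_le (T m) j (b + 1) t e (kT m) (cT m) _ _ et (bT m).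
  rewrite -addrA (_ : 1 + 1 = 2)//; apply; first by rewrite addr_ge0.
  by rewrite t0 t1.
have sub : T m.+1 `\` A `<=` (T m `\` A) `|` (E t `|` E (- t)).
  move=> x [[a Aa [y By <-]] nA].
  have [Tx|nTx] := pselect (T m (a + y)); [by left|right].
  pose y' : V := \row_i (if i == j then 0 else y 0 i).
  have Ty' : T m (a + y').
    exists a => //; exists y' => // i; rewrite /= !mxE; have := By i; rewrite /= !mxE.
    have [->|ij] := eqVneq i j; first by rewrite ltnn oppr0 lexx.
    by rewrite ltnS leq_eqVlt -val_eqE /= in ij *; rewrite (negbTE ij).
  have yj : `|y 0 j| <= t.
    by have := By j; rewrite /= !mxE/= ltnSn -ler_norml.
  have Ey (s : R) : s *: (t *: delta_mx 0 j) = (s * t) *: delta_mx 0 j :> V.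
    by rewrite scalerA.
  have yE : y = y' + y 0 j *: delta_mx 0 j.
    apply/rowP => i; rewrite !mxE eqxx/=; case: eqP => [->|_].
      by rewrite mulr1 add0r.
    by rewrite mulr0 addr0.
  have tn0 : t != 0 by rewrite gt_eqF.
  have [y0|y0] := leP 0 (y 0 j); [left|right]; split => //;
    exists (a + y') => //; exists (y 0 j *: delta_mx 0 j); rewrite -?addrA -?yE//.
    exists (y 0 j / t); last by rewrite scalerA divfK.
    rewrite divr_ge0 ?(ltW t0)//= ler_pdivrMr// mul1r.
    by rewrite (le_trans (ler_norm _)).
  exists (- y 0 j / t); last first.
    by rewrite scalerA (_ : - y 0 j / t * - t = y 0 j)//; field.
  rewrite divr_ge0 ?(ltW t0)//= ?ler_pdivrMr// ?mul1r.
    by rewrite (le_trans (ler_norm _))// normrN.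
  by rewrite oppr_ge0 ltW.
apply: le_trans (le_leb sub) _.
apply: le_trans (lebU _ _ _) _ => //.
rewrite -natr1 mulrDl mul1r EFinD leeD ?IH ?(ltnW mk)//.
apply: le_trans (lebU _ _ _) _ => //.
by rewrite mulr2n mulrDl mul1r EFinD leeD// hE// ?normrN ger0_norm// ltW.
Qed.

End Thickening.

(** * Polytopes with a bounded number of vertices *)

Section Hulls.
Variables (R : realType).

Lemma closed_of_limit (k : nat) (A : set 'rV[R]_k) :
  (forall x : 'rV[R]_k, (forall e : R, 0 < e ->
     exists2 y : 'rV[R]_k, A y & forall i, `|y 0 i - x 0 i| <= e) -> A x) -> closed A.
Proof.
move=> H; apply/closed_coordP => x nAx; apply: contrapT => h; apply: nAx.
apply: H => e e0; apply: contrapT => he; apply: h; exists e => // y ye Ay.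
by apply: he; exists y.
Qed.

Lemma lipschitz_rV_continuous (k m : nat) (f : 'rV[R]_k -> 'rV[R]_m) (L : R) :
  (forall (x y : 'rV[R]_k) (e : R), (forall i, `|x 0 i - y 0 i| <= e) ->
     forall j, `|f x 0 j - f y 0 j| <= L * e) -> continuous f.
Proof.
move=> Hf x U /nbhs_ballP[e /= e0 eU].
pose L' := `|L| + 1; have L0 : 0 < L' by rewrite ltr_pwDr.
have d0 : 0 < e / 2 / L' by rewrite !divr_gt0.
suff : nbhs x (f @^-1` U) by [].
apply/nbhs_ballP; exists (e / 2 / L') => //= y [_ xy']; apply: eU; split => // i j.
have xy a : `|x 0 a - y 0 a| <= e / 2 / L' by exact/ltW/xy'.
rewrite (ord1 i) /ball/=.
rewrite (le_lt_trans (Hf _ _ _ xy j))//.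
have : L <= L' by rewrite (le_trans (ler_norm _))// lerDl.
have e20 : 0 <= e / 2 / L' by rewrite !divr_ge0// ltW.
move=> /(ler_wpM2r e20) /le_lt_trans; apply.
by rewrite mulrC divfK ?gt_eqF//; lra.
Qed.

Definition simplex (r : nat) : set 'rV[R]_r :=
  [set w | (forall i, 0 <= w 0 i) /\ \sum_i w 0 i = 1].

(** The rows are the vertices and may repeat, so matrices of one shape encode all polytopes with at
    most [r] vertices, and compactness arguments apply to the matrix entries. *)
Definition hull_mx (r d : nat) (v : 'M[R]_(r, d)) : set 'rV[R]_d :=
  [set w *m v | w in @simplex r].

Lemma simplex_compact r : compact (@simplex r).
Proof.
apply: (@compact_coord_bounded _ _ _ 1); last first.
  move=> w [w0 w1] i; rewrite ger0_norm// -w1 (bigD1 i)//= lerDl.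
  by rewrite sumr_ge0.
apply: closed_of_limit => x Hx; split.
  move=> i; apply/ler_addgt0Pr => e e0; have [y [y0 _] /(_ i)] := Hx e e0.
  by have := y0 i; rewrite ler_norml => ? /andP[? ?]; lra.
apply/eqP; rewrite -subr_eq0 -normr_le0; apply/ler_addgt0Pr => e e0; rewrite add0r.
have e'0 : 0 < e / r.+1%:R by rewrite divr_gt0.
have [y [_ y1] yx] := Hx _ e'0.
rewrite -y1 -sumrB (le_trans (ler_norm_sum _ _ _))//.
apply: (@le_trans _ _ (\sum_(i < r) e / r.+1%:R)).
  by apply: ler_sum => i _; rewrite distrC.
rewrite sumr_const card_ord -[leLHS]mulr_natr -mulrA ler_piMr ?(ltW e0)//.
by rewrite mulrC ler_pdivrMr// mul1r ler_nat.
Qed.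

Lemma hull_mx_compact r d (v : 'M[R]_(r, d)) : compact (hull_mx v).
Proof.
apply: continuous_compact; last exact: simplex_compact.
apply: continuous_subspaceT.
apply: (@lipschitz_rV_continuous _ _ _ (\sum_i \sum_j `|v i j|)) => x y e xy j.
rewrite !mxE -sumrB (le_trans (ler_norm_sum _ _ _))// mulr_suml.
apply: ler_sum => i _; rewrite -mulrBl normrM mulrC ler_pM//.
by rewrite (bigD1 j)//= lerDl sumr_ge0.
Qed.

Lemma hull_mx_convex r d (v : 'M[R]_(r, d)) : convex_rV (hull_mx v).
Proof.
move=> _ _ t [w [w0 w1] <-] [w' [w'0 w'1] <-] /andP[t0 t1].
exists (t *: w + (1 - t) *: w'); last by rewrite mulmxDl -!scalemxAl.
split=> [i|]; first by rewrite !mxE addr_ge0// mulr_ge0// subr_ge0.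
under eq_bigr do rewrite !mxE.
by rewrite big_split -!mulr_sumr/= w1 w'1; ring.
Qed.

Lemma row_hull_mx r d (v : 'M[R]_(r, d)) i : hull_mx v (row i v).
Proof.
exists (delta_mx 0 i); last by rewrite -rowE.
split=> [j|]; first by rewrite mxE; case: (_ && _).
rewrite (bigD1 i)//= big1 ?addr0 ?mxE ?eqxx// => j ji.
by rewrite mxE (negbTE ji).
Qed.

Lemma convex_rV_sum d (A : set 'rV[R]_d) : convex_rV A ->
  forall m (w : 'I_m -> R) (p : 'I_m -> 'rV[R]_d),
  (forall i, 0 <= w i) -> \sum_(i < m) w i = 1 -> (forall i, A (p i)) ->
  A (\sum_(i < m) w i *: p i).
Proof.
move=> cA; elim=> [|m IH] w p w0 w1 Ap.
  by move: w1; rewrite big_ord0 => /esym/eqP; rewrite oner_eq0.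
rewrite big_ord_recl; move: w1; rewrite big_ord_recl => w1.
pose u := \sum_(i < m) w (lift ord0 i).
have uE : u = 1 - w ord0 by rewrite -w1 addrC addKr.
have u0 : 0 <= u by rewrite sumr_ge0.
have [/eqP uz|un0] := eqVneq u 0.
  have wz (i : 'I_m) : w (lift ord0 i) = 0.
    by have := psumr_eq0P (fun i _ => w0 (lift ord0 i)) (eqP uz); apply.
  rewrite big1 ?addr0; last by move=> i _; rewrite wz scale0r.
  by rewrite (_ : w ord0 = 1) ?scale1r//; apply/esym/eqP; rewrite -subr_eq0 -uE.
have -> : \sum_(i < m) w (lift ord0 i) *: p (lift ord0 i) =
    (1 - w ord0) *: \sum_(i < m) (w (lift ord0 i) / u) *: p (lift ord0 i).
  rewrite -uE scaler_sumr; apply: eq_bigr => i _.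
  by rewrite scalerA mulrC divfK.
apply: cA => //.
  apply: IH => //; first by move=> i; rewrite divr_ge0.
  by rewrite -mulr_suml -/u divff.
by rewrite w0/= -subr_ge0 -uE.
Qed.

Lemma hull_mx_min r d (v : 'M[R]_(r, d)) (A : set 'rV[R]_d) : convex_rV A ->
  (forall i, A (row i v)) -> hull_mx v `<=` A.
Proof.
move=> cA Av _ [w [w0 w1] <-]; rewrite mulmx_sum_row.
exact: convex_rV_sum.
Qed.

Lemma conv_hull_mx r d (v : 'M[R]_(r, d)) : conv_hull (range (fun i => row i v)) = hull_mx v.
Proof.
apply/seteqP; split => [_ [m [w [p [w0 [w1 [Ap ->]]]]]]|_ [w [w0 w1] <-]].
  apply: convex_rV_sum => //; first exact: hull_mx_convex.
  by move=> i; have [j _ <-] := Ap i; exact: row_hull_mx.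
exists r, (w 0), (fun i => row i v); split => //; split => //; split; first by move=> i; exists i.
exact: mulmx_sum_row.
Qed.

(** Rows beyond the length of [s] receive the default of [nth]; taking it to be the head of [s] adds
    no new vertex. *)
Lemma conv_hull_seq r d (s : seq 'rV[R]_d) : (0 < size s <= r)%N ->
  conv_hull [set x | x \in s] = hull_mx (\matrix_(i < r) nth (head 0 s) s i).
Proof.
move=> /andP[s0 sr]; rewrite -conv_hull_mx; congr conv_hull.
apply/seteqP; split => [x xs|_ [i _ <-]] /=.
  have ir : (index x s < r)%N by rewrite (leq_trans _ sr)// index_mem.
  by exists (Ordinal ir) => //; rewrite rowK/= nth_index.
rewrite rowK; have [i_s|si] := ltnP i (size s); first by rewrite mem_nth.
by rewrite nth_default//; case: s s0 {sr si} => //= a s _; rewrite mem_head.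
Qed.

Lemma hull_mx_thicken r d (v v' : 'M[R]_(r, d.+1)) (t : R) :
  (forall i j, `|v i j - v' i j| <= t) -> hull_mx v `<=` thicken (hull_mx v') t.
Proof.
move=> vv' _ [w [w0 w1] <-]; exists (w *m v'); first by exists w.
move=> j; rewrite !mxE -sumrB (le_trans (ler_norm_sum _ _ _))//.
rewrite -[leRHS]mul1r -w1 mulr_suml; apply: ler_sum => i _.
by rewrite -mulrBr normrM ger0_norm// ler_wpM2l.
Qed.

Lemma unit_cube_convex d : convex_rV (@unit_cube R d).
Proof.
move=> x y t Ax Ay /andP[t0 t1] i; rewrite !mxE.
by have /andP[? ?] := Ax i; have /andP[? ?] := Ay i; apply/andP; split; nra.
Qed.

Lemma unit_cube_leb d : (leb (@unit_cube R d.+1) <= 1%:E)%E.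
Proof.
have -> : @unit_cube R d.+1 = box (const_mx 0, const_mx 1).
  by apply/seteqP; split => x Hx i; have := Hx i; rewrite /= !mxE.
apply: le_trans (leb_box _ _) _ => //; rewrite lee_fin /box_vol/=.
by rewrite big1// => i _; rewrite !mxE subr0 max_r.
Qed.

Lemma Pclass_mxP r d (Q : set 'rV[R]_d.+1) : (0 < r)%N ->
  Pclass (Some r) Q <-> (0 < leb Q)%E /\
    exists2 v : 'M[R]_(r, d.+1), (forall i j, 0 <= v i j <= 1) & Q = hull_mx v.
Proof.
move=> r0; split.
  move=> [Qc Q0 [s [sr Qs]]]; split => //.
  have s0 : (0 < size s)%N.
    rewrite lt0n; apply/eqP => /size0nil s0; move: Q0.
    rewrite Qs s0 (_ : conv_hull _ = set0) ?leb0 ?ltxx//.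
    apply/seteqP; split => // x [[|m] [w [p [_ [w1 [Ap _]]]]]].
      by move: w1; rewrite big_ord0 => /esym/eqP; rewrite oner_eq0.
    by have := Ap ord0.
  rewrite (@conv_hull_seq r) ?s0// in Qs.
  exists (\matrix_(i < r) nth (head 0 s) s i) => // i j.
  have := row_hull_mx (\matrix_(i < r) nth (head 0 s) s i) i; rewrite -Qs => /Qc/(_ j).
  by rewrite [row _ _ _ _]mxE.
move=> [Q0 [v v01 QE]]; split => //.
  rewrite QE; apply: hull_mx_min; first exact: unit_cube_convex.
  by move=> i j; rewrite mxE.
exists [seq row i v | i <- enum 'I_r]; split; first by rewrite size_map size_enum_ord.
rewrite QE -conv_hull_mx; congr conv_hull; apply/seteqP; split => [_ [i _ <-]|x] /=.
  by apply: map_f; rewrite mem_enum.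
by move=> /mapP[i _ ->]; exists i.
Qed.

End Hulls.

(** * Lipschitz dependence of the volume on the vertices, existence of minimizers *)

Section MinimalPolytope.
Variable R : realType.

Lemma lipschitz_real_continuous (k : nat) (f : 'rV[R]_k -> R) (L : R) :
  (forall (x y : 'rV[R]_k) (e : R), 0 < e <= 1 ->
     (forall i, `|x 0 i - y 0 i| <= e) -> `|f x - f y| <= L * e) -> continuous f.
Proof.
move=> Hf x U /nbhs_ballP[e /= e0 eU].
pose L' := `|L| + 1; have L0 : 0 < L' by rewrite ltr_pwDr.
pose d := Num.min 1 (e / 2 / L').
have d0 : 0 < d by rewrite lt_min ltr01 !divr_gt0.
suff : nbhs x (f @^-1` U) by [].
apply/nbhs_ballP; exists d => //= y [_ xy']; apply: eU; rewrite /ball/=.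
rewrite (@le_lt_trans _ _ (L * d))//.
  apply: Hf; first by rewrite d0 ge_min lexx.
  by move=> i; apply/ltW/xy'.
have LL : L <= L' by rewrite (le_trans (ler_norm _))// lerDl.
rewrite (le_lt_trans (ler_wpM2r (ltW d0) LL))//.
apply: (@le_lt_trans _ _ (L' * (e / 2 / L'))).
  by rewrite ler_pM2l// ge_min lexx orbT.
by rewrite mulrC divfK ?gt_eqF//; lra.
Qed.

Lemma clamp_lipschitz (a b : R) :
  `|Num.min 1 (Num.max 0 a) - Num.min 1 (Num.max 0 b)| <= `|a - b|.
Proof.
have cE (x : R) : Num.min 1 (Num.max 0 x) = if x <= 0 then 0 else if 1 <= x then 1 else x.
  case: (leP 0 x) => x0; case: (leP x 0) => x0'; rewrite ?(min_r ler01)//.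
    by rewrite (_ : x = 0) ?(min_r ler01)//; apply/eqP; rewrite eq_le x0 x0'.
    by case: (leP 1 x).
  by lra.
rewrite !cE ler_norml; have := ler_norm (a - b); have := ler_norm (- (a - b)).
rewrite normrN; move: `|a - b| => N h1 h2.
by case: (leP a 0) => ?; case: (leP b 0) => ?; try case: (leP 1 a) => ?;
  try case: (leP 1 b) => ?; apply/andP; split; lra.
Qed.

Lemma leb_subcube_fin d (A : set 'rV[R]_d.+1) : A `<=` @unit_cube R d.+1 ->
  leb A \is a fin_num.
Proof.
move=> Ac; rewrite ge0_fin_numE ?leb_ge0//.
by rewrite (le_lt_trans (le_leb Ac))// (le_lt_trans (unit_cube_leb _ _))// ltry.
Qed.

Lemma unit_cube_bound d (A : set 'rV[R]_d) : A `<=` @unit_cube R d ->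
  forall x, A x -> forall i, `|x 0 i| <= 1.
Proof. by move=> Ac x /Ac + i => /(_ i) /andP[? ?]; rewrite ger0_norm. Qed.

Lemma hull_mx_cube r d (v : 'M[R]_(r, d)) : (forall i j, 0 <= v i j <= 1) ->
  hull_mx v `<=` @unit_cube R d.
Proof.
move=> v01; apply: hull_mx_min; first exact: unit_cube_convex.
by move=> i j; rewrite mxE.
Qed.

(** The constant of [leb_thicken_diff] for bodies in the unit cube, where b = 1. *)
Definition cube_lip d : R := 4 * d.+1%:R * (2 * (1 + 2)) ^+ d.+1.

Lemma leb_thicken_diff_cube d (A : set 'rV[R]_d.+1) (t : R) : compact A -> convex_rV A ->
  A `<=` @unit_cube R d.+1 -> 0 < t <= 1 ->
  (leb (thicken A t `\` A) <= (cube_lip d * t)%:E)%E.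
Proof. by move=> kA cA /unit_cube_bound Ac t01; exact: leb_thicken_diff. Qed.

Lemma leb_thicken_cube d (A : set 'rV[R]_d.+1) (t : R) : compact A -> convex_rV A ->
  A `<=` @unit_cube R d.+1 -> 0 < t <= 1 ->
  (leb (thicken A t) <= leb A + (cube_lip d * t)%:E)%E.
Proof.
move=> kA cA Ac t01.
apply: le_trans (leeD2l _ (leb_thicken_diff_cube kA cA Ac t01)).
apply: le_trans (lebU _ _ _) => //; apply: le_leb => x Tx.
by have [|] := pselect (A x); [left|right].
Qed.

Lemma leb_hull_mx_lipschitz r d (v v' : 'M[R]_(r, d.+1)) (t : R) :
  (forall i j, 0 <= v i j <= 1) -> (forall i j, 0 <= v' i j <= 1) -> 0 < t <= 1 ->
  (forall i j, `|v i j - v' i j| <= t) ->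
  `|fine (leb (hull_mx v)) - fine (leb (hull_mx v'))| <= cube_lip d * t.
Proof.
suff H (w w' : 'M[R]_(r, d.+1)) : (forall i j, 0 <= w i j <= 1) ->
   (forall i j, 0 <= w' i j <= 1) -> 0 < t <= 1 ->
   (forall i j, `|w i j - w' i j| <= t) ->
   fine (leb (hull_mx w)) <= fine (leb (hull_mx w')) + cube_lip d * t.
  move=> v01 v'01 t01 vv'; have h := H _ _ v01 v'01 t01 vv'.
  have h' : fine (leb (hull_mx v')) <= fine (leb (hull_mx v)) + cube_lip d * t.
    by apply: H => // i j; rewrite distrC.
  by rewrite ler_norml; apply/andP; split; lra.
move=> w01 w'01 t01 ww'; rewrite -lee_fin EFinD !fineK; last first.
- exact/leb_subcube_fin/hull_mx_cube.
- exact/leb_subcube_fin/hull_mx_cube.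
apply: le_trans (leb_thicken_cube _ _ _ t01); last exact: hull_mx_cube.
- exact/le_leb/hull_mx_thicken.
- exact: hull_mx_compact.
- exact: hull_mx_convex.
Qed.

Lemma hull_mx_closed_family r d (x : 'rV[R]_d.+1) :
  closed [set u : 'rV[R]_(r * d.+1) | hull_mx (vec_mx u) x].
Proof.
apply: closed_of_limit => u Hu /=.
apply: (@closed_coord_limit _ _ (hull_mx (vec_mx u))).
  by apply: compact_closed_rV; exact: hull_mx_compact.
move=> e e0; have [u' /= Hu' uu'] := Hu e e0.
have [y Hy yx] : thicken (hull_mx (vec_mx u)) e x.
  apply: hull_mx_thicken Hu' => i j.
  by rewrite !mxE.
by exists y => // i; rewrite distrC.
Qed.

(** The volume is minimized over the compact set of vertex matrices whose hull contains the sample.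
    Positive volume is not a closed condition; it is recovered from the hull of the sample, which
    lies in every candidate. *)
Lemma is_min_poly_exists r d n (X : 'I_n -> 'rV[R]_d.+1) (v0 : 'M[R]_(r, d.+1)) :
  (0 < r)%N -> (forall i j, 0 <= v0 i j <= 1) -> (forall i, hull_mx v0 (X i)) ->
  (0 < leb (conv_hull (range X)))%E -> exists P', is_min_poly r X P'.
Proof.
move=> r0 v001 Xv0 X0.
pose S := [set u : 'rV[R]_(r * d.+1) | (forall l, 0 <= u 0 l <= 1) /\
   forall i, hull_mx (vec_mx u) (X i)].
have kS : compact S.
  apply: (@compact_coord_bounded _ _ _ 1); last first.
    by move=> u [u01 _] l; have /andP[? ?] := u01 l; rewrite ger0_norm.
  apply: closed_of_limit => u Hu; split.
    move=> l; apply/andP; split.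
      apply/ler_addgt0Pr => e e0; have [y [y0 _] /(_ l)] := Hu e e0.
      by have /andP[? ?] := y0 l; rewrite ler_norml => /andP[? ?]; lra.
    apply/ler_addgt0Pr => e e0; have [y [y0 _] /(_ l)] := Hu e e0.
    by have /andP[? ?] := y0 l; rewrite ler_norml => /andP[? ?]; lra.
  move=> i; apply: (closed_coord_limit (@hull_mx_closed_family r d (X i))) => e e0.
  by have [y [_ Hy] yu] := Hu e e0; exists y => //; exact: Hy.
(* Clamping the entries to [0, 1] makes the volume continuous on the whole space and changes nothing
   on [S]. *)
pose cl (u : 'rV[R]_(r * d.+1)) : 'rV[R]_(r * d.+1) :=
  \row_l Num.min 1 (Num.max 0 (u 0 l)).
pose f u := fine (leb (hull_mx (vec_mx (cl u)))).
have cl01 u i j : 0 <= vec_mx (cl u) i j <= 1.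
  by rewrite !mxE ge_min lexx le_min ler01 le_max lexx.
have clS u : S u -> cl u = u.
  move=> [u01 _]; apply/rowP => l; rewrite mxE; have /andP[? ?] := u01 l.
  by rewrite max_r// min_r.
have cf : continuous f.
  apply: (@lipschitz_real_continuous _ f (cube_lip d)) => x y e e01 xy.
  apply: leb_hull_mx_lipschitz => // i j.
  by rewrite !mxE (le_trans (clamp_lipschitz _ _)).
have S0 : S !=set0.
  exists (mxvec v0); split; last by move=> i; rewrite mxvecK.
  by move=> l; case/mxvec_indexP: l => i j; rewrite mxvecE.
have [c /set_mem Sc cmin] := EVT_min_rV S0 kS (continuous_subspaceT cf).
have c01 i j : 0 <= vec_mx c i j <= 1 by have := cl01 c i j; rewrite clS.
exists (hull_mx (vec_mx c)); split; last 1 first.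
- move=> Q /(Pclass_mxP _ r0)[Q0 [v v01 QE]] XQ.
  have Sv : S (mxvec v).
    split; last by move=> i; rewrite mxvecK -QE.
    by move=> l; case/mxvec_indexP: l => i j; rewrite mxvecE.
  have := cmin _ (mem_set Sv); rewrite /f !clS// mxvecK -QE -lee_fin !fineK//.
    by rewrite QE; exact/leb_subcube_fin/hull_mx_cube.
  exact/leb_subcube_fin/hull_mx_cube.
- apply/(Pclass_mxP _ r0); split; last by exists (vec_mx c).
  apply: lt_le_trans X0 _; apply: le_leb => _ [m [w [p [w0 [w1 [Xp ->]]]]]].
  apply: convex_rV_sum => //; first exact: hull_mx_convex.
  by move=> i; have [j _ <-] := Xp i; exact: Sc.2.
- exact: Sc.2.
Qed.

End MinimalPolytope.

(** * Approximation of convex bodies by polytopes *)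

Section NearestPoint.
Variables (R : realType) (d : nat).
Local Notation V := 'rV[R]_d.+1.
Implicit Types (x y z u : V) (A : set V).

Definition dotv x y : R := \sum_i x 0 i * y 0 i.

Lemma dotvC x y : dotv x y = dotv y x.
Proof. by apply: eq_bigr => i _; rewrite mulrC. Qed.

Lemma dotvDr x y z : dotv x (y + z) = dotv x y + dotv x z.
Proof. by rewrite -big_split; apply: eq_bigr => i _; rewrite mxE mulrDr. Qed.

Lemma dotvZr x (a : R) y : dotv x (a *: y) = a * dotv x y.
Proof. by rewrite mulr_sumr; apply: eq_bigr => i _; rewrite mxE mulrCA. Qed.

Lemma dotvBr x y z : dotv x (y - z) = dotv x y - dotv x z.
Proof. by rewrite dotvDr -scaleN1r dotvZr mulN1r. Qed.

Lemma dotvDl x y z : dotv (y + z) x = dotv y x + dotv z x.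
Proof. by rewrite dotvC dotvDr !(dotvC x). Qed.

Lemma dotvZl (a : R) x y : dotv (a *: x) y = a * dotv x y.
Proof. by rewrite dotvC dotvZr dotvC. Qed.

Lemma dotvBl x y z : dotv (y - z) x = dotv y x - dotv z x.
Proof. by rewrite dotvC dotvBr !(dotvC x). Qed.

Lemma dotvv_ge0 x : 0 <= dotv x x.
Proof. by apply: sumr_ge0 => i _; rewrite -expr2 sqr_ge0. Qed.

Lemma dotvv_gt0 x : x != 0 -> 0 < dotv x x.
Proof.
move=> x0; rewrite lt_neqAle dotvv_ge0 andbT eq_sym; apply: contra x0 => /eqP.
move/psumr_eq0P => h; apply/eqP/rowP => i; rewrite mxE; apply/eqP.
by rewrite -sqrf_eq0 expr2 h// => j _; rewrite -expr2 sqr_ge0.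
Qed.

(** Variational inequality of the metric projection. Were D > 0, moving from [p] towards [y] by the
    fraction min(1, D / N) would come strictly closer to [x]. *)
Lemma nearest_point A x : compact A -> convex_rV A -> A !=set0 ->
  exists2 p, A p & forall y, A y -> dotv (x - p) (y - p) <= 0.
Proof.
move=> kA cA A0; pose f y : R := dotv (x - y) (x - y).
have cf : continuous f.
  apply: (@continuous_big _ _ +%R 0 xpredT _ _ _ (fun i y => (x - y) 0 i * (x - y) 0 i)) => [p|i _].
    by apply: cvgD; [exact: cvg_fst|exact: cvg_snd].
  have c1 : continuous (fun y : V => (x - y) 0 i).
    apply: (@lipschitz_real_continuous _ _ _ 1) => y z e _ yz.
    rewrite !mxE mul1r (le_trans _ (yz i))// -normrN le_eqVlt; apply/orP; left.
    by apply/eqP; congr `|_|; ring.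
  by move=> y; apply: continuousM; exact: c1.
have [p /set_mem Ap pmin] := EVT_min_rV A0 kA (continuous_subspaceT cf).
exists p => // y Ay; rewrite leNgt; apply/negP => D0.
set D := dotv (x - p) (y - p) in D0.
pose N := dotv (y - p) (y - p).
have N0 : 0 <= N by exact: dotvv_ge0.
have key (t : R) : 0 <= t <= 1 -> 0 <= t ^+ 2 * N - 2 * t * D.
  move=> t01; have := pmin _ (mem_set (cA _ _ t Ay Ap t01)).
  have -> : f (t *: y + (1 - t) *: p) = f p + (t ^+ 2 * N - 2 * t * D).
    rewrite /f; have -> : x - (t *: y + (1 - t) *: p) = (x - p) - t *: (y - p).
      by apply/rowP => i; rewrite !mxE; ring.
    rewrite /D /N; move: (x - p) (y - p) => w q.
    by rewrite !(dotvBl, dotvBr, dotvZl, dotvZr) (dotvC q w); ring.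
  by rewrite lerDl.
have [ND|DN] := leP N D.
  by have := key 1; rewrite ler01 lexx => /(_ erefl); nra.
have N0' : 0 < N by exact: lt_trans DN.
have := key (D / N); rewrite divr_ge0 ?(ltW D0)//= ler_pdivrMr// mul1r ltW// => /(_ erefl).
have -> : (D / N) ^+ 2 * N - 2 * (D / N) * D = - (D ^+ 2 / N) by field; rewrite gt_eqF.
by rewrite oppr_ge0 leNgt divr_gt0// exprn_gt0.
Qed.

Lemma strict_separation A x : compact A -> convex_rV A -> A !=set0 -> ~ A x ->
  exists u, forall y, A y -> dotv u y < dotv u x.
Proof.
move=> kA cA A0 nAx; have [p Ap Hp] := nearest_point x kA cA A0.
exists (x - p) => y /Hp; rewrite dotvBr subr_le0 => /le_lt_trans; apply.
rewrite -subr_gt0 -dotvBr dotvv_gt0// subr_eq0; apply/eqP => xp.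
by apply: nAx; rewrite xp.
Qed.

End NearestPoint.

Section FamilyHull.
Variables (R : realType) (d : nat).
Local Notation V := 'rV[R]_d.+1.

(** Indexing vertices by a structured finite type turns the vertex count into the computation of a
    cardinal. *)
Definition hull_fam (T : finType) (p : T -> V) : set V :=
  hull_mx (\matrix_(i < #|T|) p (enum_val i)).

Lemma hull_fam_mem (T : finType) (p : T -> V) t : hull_fam p (p t).
Proof.
have := row_hull_mx (\matrix_(i < #|T|) p (enum_val i)) (enum_rank t).
by rewrite rowK enum_rankK.
Qed.

Lemma hull_fam_min (T : finType) (p : T -> V) (C : set V) :
  convex_rV C -> (forall t, C (p t)) -> hull_fam p `<=` C.
Proof. by move=> cC Cp; apply: hull_mx_min => // i; rewrite rowK. Qed.

Lemma hull_fam_convex (T : finType) (p : T -> V) : convex_rV (hull_fam p).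
Proof. exact: hull_mx_convex. Qed.

Lemma thicken_minkowski (A : set V) (t : R) :
  thicken A t = minkowski A (box (const_mx (- t), const_mx t)).
Proof.
apply/seteqP; split => [x [a Aa xa]|_ [a Aa [y By <-]]].
  exists a => //; exists (x - a); last by rewrite addrC subrK.
  by move=> i; have := xa i; rewrite /= !mxE ler_norml.
by exists a => // i; have := By i; rewrite /= !mxE -ler_norml (addrC (a 0 i)) addrK.
Qed.

Lemma thicken_convex (A : set V) (t : R) : convex_rV A -> convex_rV (thicken A t).
Proof.
move=> cA; rewrite thicken_minkowski.
by apply: minkowski_convex => //; exact: box_convex.
Qed.

Lemma thicken_compact (A : set V) (t : R) : compact A -> compact (thicken A t).
Proof.
move=> kA; rewrite thicken_minkowski.
by apply: minkowski_compact => //; exact: box_compact.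
Qed.

(** Interpolation in one coordinate at a time: in the induction, [th] may be fractional in its first
    [m] coordinates only. *)
Lemma convex_box_corners (C : set V) (a l : 'I_d.+1 -> R) : convex_rV C ->
  (forall s : {ffun 'I_d.+1 -> bool}, C (\row_j (a j + (if s j then l j else 0)))) ->
  forall th : 'I_d.+1 -> R, (forall j, 0 <= th j <= 1) -> C (\row_j (a j + th j * l j)).
Proof.
move=> cC Cs.
suff H m (th : 'I_d.+1 -> R) : (m <= d.+1)%N -> (forall j, 0 <= th j <= 1) ->
    (forall j : 'I_d.+1, (m <= j)%N -> th j = 0 \/ th j = 1) -> C (\row_j (a j + th j * l j)).
  by move=> th th01; apply: (H d.+1) => // j; rewrite leqNgt ltn_ord.
elim: m th => [|m IH] th md th01 thj.
  have := Cs [ffun j => th j == 1]; congr C; apply/rowP => j; rewrite !mxE ffunE.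
  by have [->|->] := thj j isT; rewrite ?eqxx ?mul1r// eq_sym oner_eq0 mul0r.
pose j0 : 'I_d.+1 := Ordinal md.
pose th' (b : R) j := if j == j0 then b else th j.
have Hb (b : R) : b = 0 \/ b = 1 -> C (\row_j (a j + th' b j * l j)).
  move=> hb; apply: IH; first exact: ltnW.
    by move=> j; rewrite /th'; case: eqP => // _; case: hb => ->; rewrite lexx ler01.
  move=> j mj; rewrite /th'; case: eqP => // /eqP; rewrite -val_eqE /= => jm.
  by apply: thj; rewrite ltn_neqAle eq_sym jm.
have -> : \row_j (a j + th j * l j) = th j0 *: (\row_j (a j + th' 1 j * l j))
    + (1 - th j0) *: (\row_j (a j + th' 0 j * l j)).
  by apply/rowP => j; rewrite !mxE /th'; case: eqP => [->|_]; ring.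
by apply: cC => //; apply: Hb; [right|left].
Qed.

End FamilyHull.

(** * Dudley's approximation by projected grid points *)

Section Dudley.
Variables (R : realType) (d : nat).
Local Notation V := 'rV[R]_d.+1.

(** A face x_i = 2 or x_i = -1, and a grid of mesh 1/M of [-2, 3] in the other coordinates. A ray
    from the unit cube, followed to the face of its dominant coordinate, moves by at most 2 in every
    coordinate; the length 5 of the interval gives 5M + 1 values. *)
Definition dudley_grid (M : nat) : finType :=
  ('I_d.+1 * bool * {ffun 'I_d -> 'I_(5 * M).+1})%type.

Definition dudley_point (M : nat) (g : dudley_grid M) : V :=
  \row_i (if unlift g.1.1 i is Some i' then - 2 + (g.2 i')%:R / M%:R
          else if g.1.2 then 2 else -1).

Lemma grid_approx (M K : nat) (a y : R) : (0 < M)%N -> a <= y -> (y - a) * M%:R <= K%:R ->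
  exists k : 'I_K.+1, `|a + k%:R / M%:R - y| <= M%:R^-1.
Proof.
move=> M0 ay yK; have MR : 0 < M%:R :> R by rewrite ltr0n.
have h0 : 0 <= (y - a) * M%:R by rewrite mulr_ge0 ?subr_ge0// ltW.
have /andP[k1 k2] := truncn_itv h0; set k := Num.truncn _ in k1 k2.
have kK : (k < K.+1)%N by rewrite ltnS -(ler_nat R) (le_trans k1).
exists (Ordinal kK) => /=.
have -> : a + k%:R / M%:R - y = (k%:R - (y - a) * M%:R) / M%:R by field; rewrite gt_eqF.
have V0 : 0 <= M%:R^-1 :> R by rewrite invr_ge0 ltW.
rewrite normrM [X in _ * X]ger0_norm// ler_piMl//.
by rewrite -natr1 in k2; rewrite ler_norml; apply/andP; split; lra.
Qed.

(* The approximating points are the metric projections to K of a grid on the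
   boundary of a larger cube.  If x in K is far from their hull in a direction u,
   then the ray from x along u leaves the large cube near a grid point g, and the
   obtuse angle at the projection of g contradicts the separation. *)
Lemma dudley_approx (K : set V) (M : nat) : compact K -> convex_rV K -> K !=set0 ->
  K `<=` @unit_cube R d.+1 -> (0 < M)%N ->
  exists p : dudley_grid M -> V, (forall g, K (p g)) /\
    K `<=` thicken (hull_fam p) (d.+1%:R / (4 * M%:R ^+ 2)).
Proof.
move=> kK cK K0 Kc M0.
have /choice[p Hp] : forall g : dudley_grid M, exists p, K p /\
    forall y, K y -> dotv (dudley_point g - p) (y - p) <= 0.
  by move=> g; have [p] := nearest_point (dudley_point g) kK cK K0; exists p.
exists p; split=> [g|x Kx]; first by have [] := Hp g.
set eta := d.+1%:R / _.
have MR : 0 < M%:R :> R by rewrite ltr0n.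
have eta0 : 0 < eta by rewrite divr_gt0// mulr_gt0// exprn_gt0.
apply: contrapT => nTx.
have T0 : thicken (hull_fam p) eta !=set0.
  pose g0 : dudley_grid M := ((ord0, true), [ffun=> ord0]).
  exists (p g0); exists (p g0); first exact: hull_fam_mem.
  by move=> i; rewrite subrr normr0 ltW.
have kT : compact (thicken (hull_fam p) eta).
  by apply: thicken_compact; exact: hull_mx_compact.
have cT : convex_rV (thicken (hull_fam p) eta).
  by apply: thicken_convex; exact: hull_fam_convex.
have [u Hu] := strict_separation kT cT T0 nTx.
pose j := [arg max_(i > ord0) `|u 0 i|]%O.
have umax i : `|u 0 i| <= `|u 0 j|.
  by rewrite /j; case: arg_maxP => // j' _; apply.
have uj0 : 0 < `|u 0 j|.
  rewrite normr_gt0; apply/eqP => uj; have [y /Hu] := T0.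
  suff -> : u = 0 by rewrite /dotv !big1 ?ltxx// => i _; rewrite mxE mul0r.
  by apply/rowP => i; rewrite mxE; apply/eqP; rewrite -normr_le0 (le_trans (umax i))// uj normr0.
pose b := 0 < u 0 j.
pose t : R := ((if b then 2 else -1) - x 0 j) / u 0 j.
have uj_neq0 : u 0 j != 0 by rewrite -normr_gt0.
have /andP[x0 x1] := Kc _ Kx j.
have t12 : 1 <= t * `|u 0 j| <= 2.
  rewrite /t /b; case: (ltP 0 (u 0 j)) => uj.
    by rewrite gtr0_norm// divfK//; apply/andP; split; lra.
  by rewrite ler0_norm// mulrN divfK//; apply/andP; split; lra.
have t0 : 0 < t by rewrite -(pmulr_lgt0 _ uj0); case/andP: t12 => h _; lra.
pose g := x + t *: u.
have gi i : - 2 <= g 0 i <= 3.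
  have /andP[? ?] := Kc _ Kx i.
  have : `|t * u 0 i| <= 2.
    rewrite normrM (gtr0_norm t0) (le_trans (ler_wpM2l (ltW t0) (umax i)))//.
    by case/andP: t12.
  by rewrite !mxE ler_norml => /andP[? ?]; apply/andP; split; lra.
have /fin_all_exists[f Hf] (i' : 'I_d) :
    exists k : 'I_(5 * M).+1, `|- 2 + k%:R / M%:R - g 0 (lift j i')| <= M%:R^-1.
  have /andP[g1 g2] := gi (lift j i'); apply: grid_approx => //.
  by rewrite natrM ler_pM2r//; lra.
pose G : dudley_grid M := ((j, b), [ffun i' => f i']).
pose e := dudley_point G - g.
have ei i : `|e 0 i| <= M%:R^-1.
  rewrite !mxE /=; case: unliftP => [i' ->|->]; first by rewrite ffunE; have := Hf i'; rewrite !mxE.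
  rewrite -/(t) (_ : t * u 0 j = (if b then 2 else -1) - x 0 j); last by rewrite divfK.
  by rewrite addrCA subrr addr0 subrr normr0 invr_ge0 ltW.
set s := p G; pose y := x - s.
have [Ks /(_ x Kx)] := Hp G; rewrite -/s.
have -> : dudley_point G - s = y + t *: u + e.
  by apply/rowP => i; rewrite /y /e /g !mxE; ring.
rewrite -/y (dotvDl y (y + t *: u) e) (dotvDl y y (t *: u)) dotvZl => obt.
(* Completing the square, each coordinate gives y^2 + e y >= -e^2 / 4 >= -1 / (4 M^2); the d + 1
   coordinates add up to [eta]. *)
have ey : - eta <= dotv y y + dotv e y.
  rewrite /dotv -big_split /= (@le_trans _ _ (\sum_(i < d.+1) - (4 * M%:R ^+ 2)^-1))//.
    rewrite sumr_const card_ord (_ : _ *+ _ = - eta)//.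
    by rewrite mulNrn /eta -[X in - X = _]mulr_natl.
  apply: ler_sum => i _; have := ei i; rewrite ler_norml => /andP[e1 e2].
  have -> : (4 * M%:R ^+ 2)^-1 = (M%:R^-1) ^+ 2 / 4 :> R by field; rewrite gt_eqF.
  move: (e 0 i) (y 0 i) (M%:R^-1) e1 e2 => ee yy m e1 e2.
  have : 0 <= (yy + ee / 2) ^+ 2 by rewrite sqr_ge0.
  have : ee ^+ 2 <= m ^+ 2 by nra.
  nra.
have tuy : t * dotv u y <= eta by lra.
(* The point of the thickening that goes furthest from [s] along coordinate [j]: separation gives
   eta |u_j| < u.y, against t (u.y) <= eta and t |u_j| >= 1. *)
pose z : V := s + (eta * Num.sg (u 0 j)) *: delta_mx 0 j.
have Tz : thicken (hull_fam p) eta z.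
  exists s; first exact: hull_fam_mem.
  move=> i; rewrite mxE (addrC (s 0 i)) addrK !mxE eqxx/= normrM.
  rewrite (normrM eta) normr_sg uj_neq0 mulr1 (gtr0_norm eta0).
  by case: (i == j); rewrite ?normr1 ?normr0 ?mulr1// mulr0 ltW.
have := Hu z Tz; rewrite /z dotvDr dotvZr.
have -> : dotv u (delta_mx 0 j) = u 0 j.
  rewrite /dotv (bigD1 j)//= big1 ?addr0 ?mxE ?eqxx ?mulr1// => i ij.
  by rewrite mxE (negbTE ij) andbF mulr0.
rewrite -mulrA -normrEsg => sep.
have : eta * `|u 0 j| < dotv u y by rewrite /y dotvBr; lra.
move: tuy t12 uj0 eta0 t0; move: (dotv u y) `|u 0 j| => uy a tuy /andP[t1 _] a0 eta0 t0 ua.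
have : t * (eta * a) < t * uy by rewrite ltr_pM2l.
have : eta <= eta * (t * a) by rewrite ler_peMr// ltW.
nra.
Qed.

End Dudley.

(** * Enclosing polytopes that stay in the cube *)

Section OuterApproximation.
Variables (R : realType) (d : nat).
Local Notation V := 'rV[R]_d.+1.

Let cell_lo (de : R) (c : option bool) : R :=
  match c with None => de | Some false => 0 | Some true => 1 - de end.
Let cell_hi (de : R) (c : option bool) : R :=
  match c with None => 1 - de | Some false => de | Some true => 1 end.
Let corner_base (de : R) (c : option bool) (z : R) : R :=
  match c with None => z - de | Some false => 0 | Some true => 1 - de end.
Let corner_len (de : R) (c : option bool) : R :=
  match c with None => 2 * de | _ => de end.

Definition corner_index (M : nat) : finType :=
  (dudley_grid d M * {ffun 'I_d.+1 -> bool})%type.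

(* A coordinate that stays at distance at least [de] from the faces of the cube is
   thickened by [de] on both sides; a coordinate close to a face is replaced by the
   full interval of length [de] next to that face.  The corners of the resulting
   boxes remain in the cube. *)
Lemma cell_outer_approx (K : set V) (s : {ffun 'I_d.+1 -> option bool}) (M : nat) (de : R) :
  compact K -> convex_rV K -> K !=set0 -> K `<=` @unit_cube R d.+1 -> (0 < M)%N ->
  de = d.+1%:R / (4 * M%:R ^+ 2) -> de <= 1 ->
  exists q : corner_index M -> V, (forall g, unit_cube (q g) /\ thicken K de (q g)) /\
    forall x, K x -> (forall j, cell_lo de (s j) <= x 0 j <= cell_hi de (s j)) ->
      hull_fam q x.
Proof.
move=> kK cK K0 Kc M0 deE de1.
have de0 : 0 < de by rewrite deE divr_gt0// mulr_gt0// exprn_gt0// ltr0n.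
pose K' := K `&` box (\row_j cell_lo de (s j), \row_j cell_hi de (s j)).
have K'E x : K' x <-> K x /\ forall j, cell_lo de (s j) <= x 0 j <= cell_hi de (s j).
  by split=> -[Kx Bx]; split=> // j; have := Bx j; rewrite /= !mxE.
have [[x0 K'x0]|nK'] := pselect (K' !=set0); last first.
  have [x0 Kx0] := K0; exists (fun=> x0); split=> [g|x Kx Bx]; last first.
    by exfalso; apply: nK'; exists x; apply/K'E.
  split; first exact: Kc.
  by exists x0 => // i; rewrite subrr normr0 ltW.
have kK' : compact K'.
  apply: (@compact_coord_bounded _ _ _ 1).
    apply: closedI; first exact: compact_closed_rV.
    exact: box_closed.
  by move=> x [/Kc Cx _] i; have /andP[? ?] := Cx i; rewrite ger0_norm.
have cK' : convex_rV K'.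
  move=> x y t [Kx Bx] [Ky By] t01; split; first exact: cK.
  exact: box_convex.
have K'c : K' `<=` @unit_cube R d.+1 by move=> x [/Kc].
have [p [Kp Hp]] := dudley_approx kK' cK' (ex_intro _ x0 K'x0) K'c M0.
rewrite -deE in Hp.
pose a (z : V) j := corner_base de (s j) (z 0 j).
pose l j := corner_len de (s j).
pose q (g : corner_index M) : V := \row_j (a (p g.1) j + (if g.2 j then l j else 0)).
exists q; split=> [g|x Kx Bx].
  have [Kpg Bpg] := (K'E _).1 (Kp g.1); split.
    move=> j; rewrite mxE /a /l; have := Bpg j.
    by case: (s j) => [[]|]; case: (g.2 j) => /= /andP[? ?]; apply/andP; split; lra.
  exists (p g.1) => // j; rewrite mxE /a /l; have := Bpg j.
  by case: (s j) => [[]|]; case: (g.2 j) => /= /andP[? ?];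
    rewrite ler_norml; apply/andP; split; lra.
have [y Hy xy] := Hp x ((K'E _).2 (conj Kx Bx)).
(* The points whose whole box lies in the hull of the corners. The base of the box is affine in z
   and its side lengths are constant, so this set is convex; it contains each [p g], hence their
   hull. *)
pose C' : set V := [set z | forall th : 'I_d.+1 -> R, (forall j, 0 <= th j <= 1) ->
   hull_fam q (\row_j (a z j + th j * l j))].
have cC' : convex_rV C'.
  move=> z z' t Cz Cz' t01 th th01.
  have -> : \row_j (a (t *: z + (1 - t) *: z') j + th j * l j) =
     t *: (\row_j (a z j + th j * l j)) + (1 - t) *: (\row_j (a z' j + th j * l j)).
    apply/rowP => j; rewrite !mxE /a /corner_base !mxE.
    by case: (s j) => [[]|]; ring.
  by apply: hull_fam_convex => //; [exact: Cz|exact: Cz'].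
have C'p g : C' (p g).
  move=> th th01; apply: convex_box_corners => //; first exact: hull_fam_convex.
  by move=> tau; have := hull_fam_mem q (g, tau).
have l0 j : 0 < l j by rewrite /l /corner_len; case: (s j) => [_|]; lra.
have -> : x = \row_j (a y j + (x 0 j - a y j) / l j * l j).
  by apply/rowP => j; rewrite !mxE divfK ?gt_eqF// addrC subrK.
apply: (hull_fam_min cC' C'p Hy) => j.
rewrite ler_pdivrMr// mul1r divr_ge0 ?(ltW (l0 j))//=; last first.
  rewrite subr_ge0 /a /corner_base; have := Bx j; have := xy j.
  by case: (s j) => [[]|] /=; rewrite ler_norml => /andP[? ?] /andP[? ?]; lra.
rewrite /a /l /corner_base /corner_len; have := Bx j; have := xy j.
by case: (s j) => [[]|] /=; rewrite ler_norml => /andP[? ?] /andP[? ?]; lra.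
Qed.

(** 3^(d+1) cells, 2(d+1) faces with (5M + 1)^d <= (6(d+1))^d m^d grid points each, and 2^(d+1)
    corners per point. *)
Definition outer_const : nat :=
  (3 ^ d.+1 * (d.+1 * 2 * (6 * d.+1) ^ d * 2 ^ d.+1))%N.

Lemma outer_approx (K : set V) (m : nat) :
  compact K -> convex_rV K -> K !=set0 -> K `<=` @unit_cube R d.+1 -> (0 < m)%N ->
  exists (r : nat) (v : 'M[R]_(r, d.+1)), [/\ (0 < r <= outer_const * m ^ d)%N,
    (forall i j, 0 <= v i j <= 1), K `<=` hull_mx v &
    hull_mx v `<=` thicken K (m%:R ^+ 2)^-1].
Proof.
(* With M = (d+1) m the accuracy (d+1) / (4 M^2) equals 1 / (4 (d+1) m^2), below the required 1 /
   m^2. *)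
move=> kK cK K0 Kc m0; pose M := (d.+1 * m)%N.
have M0 : (0 < M)%N by rewrite muln_gt0.
pose de : R := d.+1%:R / (4 * M%:R ^+ 2).
have mR : 1 <= m%:R :> R by rewrite ler1n.
have dR : 1 <= d.+1%:R :> R by rewrite ler1n.
have mV : 0 < (m%:R ^+ 2)^-1 :> R by rewrite invr_gt0 exprn_gt0// ltr0n.
have deE : de = (m%:R ^+ 2)^-1 / (4 * d.+1%:R).
  have mn0 : m%:R != 0 :> R by rewrite gt_eqF// (lt_le_trans ltr01).
  have dn0 : d.+1%:R != 0 :> R by rewrite gt_eqF// (lt_le_trans ltr01).
  by rewrite /de /M natrM; move: (d.+1%:R) dn0 => D dn0; field; rewrite mn0 dn0.
have dem : de <= (m%:R ^+ 2)^-1.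
  rewrite deE ler_pdivrMr ?mulr_gt0 ?ltr0n// ler_peMr ?(ltW mV)//; lra.
have de1 : de <= 1.
  by rewrite (le_trans dem)// invf_le1 ?exprn_gt0 ?ltr0n// exprn_ege1.
have /choice[q Hq] s := @cell_outer_approx K s M de kK cK K0 Kc M0 erefl de1.
pose T : finType := ({ffun 'I_d.+1 -> option bool} * corner_index M)%type.
pose Q (x : T) : V := q x.1 x.2.
exists #|T|, (\matrix_(i < #|T|) Q (enum_val i)); split.
- apply/andP; split.
    apply/card_gt0P; pose g0 : dudley_grid d M := ((ord0, true), [ffun=> ord0]).
    by exists ([ffun=> None], (g0, [ffun=> true])).
  rewrite !card_prod !card_ffun card_option card_bool !card_ord.
  have H : ((5 * M).+1 ^ d <= (6 * d.+1) ^ d * m ^ d)%N.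
    have leX e : ((5 * M).+1 ^ e <= (6 * d.+1 * m) ^ e)%N.
      by case: e => // e; rewrite leq_exp2r// /M; nia.
    by rewrite -expnMn leX.
  apply: (leq_trans (leq_mul (leqnn _) (leq_mul (leq_mul (leqnn _) H) (leqnn _)))).
  by rewrite leq_eqVlt; apply/orP; left; apply/eqP; rewrite /outer_const; ring.
- move=> i j; rewrite mxE; have [] := (Hq (enum_val i).1).1 (enum_val i).2.
  by move=> /(_ j).
- move=> x Kx.
  pose s : {ffun 'I_d.+1 -> option bool} := [ffun j =>
    if x 0 j <= de then Some false else if 1 - de <= x 0 j then Some true else None].
  have : hull_fam (q s) x.
    apply: (Hq s).2 => // j; rewrite ffunE; have /andP[? ?] := Kc _ Kx j.
    case: (leP (x 0 j) de) => ? /=; first by apply/andP; split.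
    by case: (leP (1 - de) (x 0 j)) => ? /=; apply/andP; split => //; exact: ltW.
  apply: hull_fam_min; first exact: hull_fam_convex.
  by move=> g; exact: (hull_fam_mem Q (s, g)).
- apply: hull_fam_min; first exact: thicken_convex.
  move=> [s g]; have [_ [y Ky yq]] := (Hq s).1 g.
  by exists y => // i; rewrite (le_trans (yq i)).
Qed.

End OuterApproximation.

(** * Degenerate samples form a null set *)

Section Hyperplanes.
Variables (R : realType) (d : nat).
Local Notation V := 'rV[R]_d.+1.

(** If the box were null, finitely many translates of it would cover the cube, and [P] would be
    null. No lower bound on the measure of a box is computed. *)
Lemma leb_small_box_gt0 (P : set V) (t : R) (c : V) : P `<=` @unit_cube R d.+1 ->
  (0 < leb P)%E -> 0 < t ->
  (0 < leb [set y : V | forall i, (`|y 0 i - c 0 i| <= t)%R])%E.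
Proof.
move=> Pc P0 t0; rewrite lt_neqAle leb_ge0 andbT; apply/eqP => /esym B0.
have [m mt] := ltr_add_invr (y := 0) (x := t) t0; rewrite add0r in mt.
pose N := m.+1; have NR : 0 < N%:R :> R by rewrite ltr0n.
pose ctr (f : {ffun 'I_d.+1 -> 'I_N}) : V := \row_i ((f i)%:R / N%:R).
pose B (f : {ffun 'I_d.+1 -> 'I_N}) := [set y : V | forall i, `|y 0 i - ctr f 0 i| <= t].
have lB f : leb (B f) = 0.
  rewrite -B0 -(leb_shift (c - ctr f)); congr leb; apply/seteqP; split.
    move=> _ [y By <-] i; have := By i; rewrite !mxE.
    by rewrite (_ : y 0 i + _ - _ = y 0 i - (f i)%:R / N%:R)//; ring.
  move=> y By; exists (y - (c - ctr f)); last by rewrite subrK.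
  move=> i; have := By i; rewrite !mxE.
  by rewrite (_ : y 0 i - (_ - _) - _ = y 0 i - c 0 i)//; ring.
suff : (leb P <= 0)%E by rewrite leNgt P0.
apply: (@le_trans _ _ (\sum_f leb (B f))%E); last by rewrite big1.
apply: le_trans (leb_fin_bigcup _ _) => //; apply: le_leb => x /Pc xc.
have /fin_all_exists[f Hf] (i : 'I_d.+1) :
    exists k : 'I_N, `|x 0 i - k%:R / N%:R| <= t.
  have /andP[x0 x1] := xc i.
  have h0 : 0 <= x 0 i * N%:R by rewrite mulr_ge0// ltW.
  have /andP[k1 k2] := truncn_itv h0; set k := Num.truncn _ in k1 k2.
  have tN : 1 <= t * N%:R by rewrite -ler_pdivrMr// mul1r ltW.
  have [kN|Nk] := ltnP k N.
    exists (Ordinal kN); rewrite -(ler_pM2r NR) -{2}(gtr0_norm NR) -normrM mulrBl divfK ?gt_eqF//=.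
    by rewrite -natr1 in k2; rewrite ler_norml; apply/andP; split; lra.
  exists ord_max; rewrite -(ler_pM2r NR) -{2}(gtr0_norm NR) -normrM mulrBl divfK ?gt_eqF//=.
  have xN : N%:R <= x 0 i * N%:R by rewrite (le_trans _ k1)// ler_nat.
  have xN' : x 0 i * N%:R <= N%:R by rewrite ler_piMl// ltW.
  have mN : m%:R = N%:R - 1 :> R by rewrite /N -natr1 addrK.
  by rewrite mN ler_norml; apply/andP; split; lra.
by exists [ffun i => f i] => // i; rewrite mxE ffunE.
Qed.

(** If the centred sample matrix has full column rank, its pseudo-inverse writes a point near the
    centroid with small coefficients; otherwise a kernel vector is normal to a hyperplane through
    the sample. *)
Lemma hyperplane_or_box (n : nat) (X : 'I_n.+1 -> V) :
  (exists u : V, u != 0 /\ exists b, forall i, dotv u (X i) = b) \/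
  (exists (c : V) (t : R), 0 < t /\
     [set y : V | forall i, `|y 0 i - c 0 i| <= t] `<=` conv_hull (range X)).
Proof.
have nR : 0 < n.+1%:R :> R by rewrite ltr0n.
have nn0 : n.+1%:R != 0 :> R by rewrite gt_eqF.
pose c : V := n.+1%:R^-1 *: \sum_i X i.
pose M : 'M[R]_(n.+1, d.+1) := \matrix_i (X i - c).
have [Mfull|Mnfull] := boolP (row_full M); [right|left]; last first.
  move: Mnfull.
  have -> : row_full M = row_free M^T by rewrite /row_full /row_free mxrank_tr.
  rewrite -kermx_eq0.
  move=> /rowV0Pn[u /sub_kermxP uM u0]; exists u; split => //.
  exists (dotv u c) => i; apply/eqP; rewrite -subr_eq0 -dotvBr.
  move/rowP: uM => /(_ i); rewrite !mxE => <-; apply/eqP; apply: eq_bigr => j _.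
  by rewrite !mxE.
pose B : R := \sum_i \sum_j `|pinvmx M i j| + 1.
have B0 : 0 < B by rewrite ltr_wpDl// sumr_ge0// => i _; rewrite sumr_ge0.
exists c, (2 * n.+1%:R * B)^-1; split; first by rewrite invr_gt0 !mulr_gt0.
move=> y yc; pose w : 'rV[R]_n.+1 := (y - c) *m pinvmx M.
have wM : w *m M = y - c by rewrite mulmxKpV// submx_full.
have wb i : `|w 0 i| <= (2 * n.+1%:R)^-1.
  rewrite mxE (le_trans (ler_norm_sum _ _ _))//.
  apply: (@le_trans _ _ (\sum_j (2 * n.+1%:R * B)^-1 * `|pinvmx M j i|)).
    apply: ler_sum => j _; rewrite normrM ler_wpM2r//.
    by have := yc j; rewrite !mxE.
  rewrite -mulr_sumr invfM mulrAC -mulrA ler_piMr ?invr_ge0 ?mulr_ge0//.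
  rewrite ler_pdivrMr// mul1r /B ler_wpDr//.
  by apply: ler_sum => j _; rewrite (bigD1 i)//= lerDl sumr_ge0.
(* Subtracting the mean makes the weights 1/(n+1) + w_i - mw sum to 1. Both corrections are at most
   half of 1/(n+1), so the weights stay nonnegative. *)
pose mw := n.+1%:R^-1 * \sum_i w 0 i.
have mwb : `|mw| <= (2 * n.+1%:R)^-1.
  rewrite normrM ger0_norm ?invr_ge0// mulrC ler_pdivrMr//.
  rewrite (le_trans (ler_norm_sum _ _ _))//.
  apply: (@le_trans _ _ (\sum_(i < n.+1) (2 * n.+1%:R)^-1)); first exact: ler_sum.
  by rewrite sumr_const card_ord -[leLHS]mulr_natr.
have hn : (2 * n.+1%:R)^-1 + (2 * n.+1%:R)^-1 = n.+1%:R^-1 :> R.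
  by move: (n.+1%:R) nn0 => nr nn0; field.
exists n.+1, (fun i => n.+1%:R^-1 + w 0 i - mw), X; split; [|split; [|split]].
- move=> i; have := wb i; have := mwb; rewrite !ler_norml -hn.
  move: ((2 * n.+1%:R)^-1) (mw) (w 0 i) => p mw' wi /andP[_ ?] /andP[? _].
  by lra.
- rewrite !(big_split, sumrB)/= sumrN !sumr_const card_ord /mw -[_^-1 *+ _]mulr_natr mulVf//.
  by rewrite -[_ *+ _]mulr_natr mulrAC mulVf// mul1r addrK.
- by move=> i; exists i.
- have -> : y = c + w *m M by rewrite wM addrC subrK.
  rewrite mulmx_sum_row.
  under eq_bigr do rewrite rowK scalerBr.
  under [RHS]eq_bigr do rewrite scalerBl scalerDl.
  rewrite !sumrB big_split/= -!scaler_sumr -!scaler_suml -/c -addrA; congr (_ + (_ - _)).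
  by rewrite /c scalerA mulrC.
Qed.

Definition slab (u : V) (b e : R) : set V := [set x | unit_cube x /\ `|dotv u x - b| <= e].

Lemma dotv_near (u x y : V) (e : R) : (forall i, `|x 0 i - y 0 i| <= e) ->
  `|dotv u x - dotv u y| <= (\sum_i `|u 0 i|) * e.
Proof.
move=> xy; rewrite -dotvBr (le_trans (ler_norm_sum _ _ _))// mulr_suml.
by apply: ler_sum => i _; rewrite normrM !mxE ler_wpM2l.
Qed.

(* The slab is contained in the shell swept by a half-space in the direction of the
   coordinate along which [u] equals 1. *)
Lemma leb_slab (u : V) (j : 'I_d.+1) (b e : R) : u 0 j = 1 -> 0 < e -> 4 * e <= 1 ->
  (leb (slab u b e) <= (2 * 6 ^+ d.+1 * (4 * e))%:E)%E.
Proof.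
move=> uj e0 e1.
pose A : set V := box (const_mx (-2), const_mx 2) `&` [set x | dotv u x <= b - 2 * e].
have Ab x : A x -> forall i, `|x 0 i| <= 2.
  by move=> [Bx _] i; have := Bx i; rewrite !mxE ler_norml.
have kA : compact A.
  apply: (compact_coord_bounded _ Ab); apply: closedI; first exact: box_closed.
  apply: closed_of_limit => x Hx /=; apply/ler_addgt0Pr => h h0.
  pose U : R := \sum_i `|u 0 i| + 1.
  have U0 : 0 < U by rewrite ltr_wpDl// sumr_ge0.
  have [y /= Hy yx] := Hx (h / U) (divr_gt0 h0 U0).
  have := dotv_near u yx; rewrite ler_norml => /andP[+ _].
  have : (\sum_i `|u 0 i|) * (h / U) <= h.
    rewrite mulrCA ler_piMr ?(ltW h0)// ler_pdivrMr// mul1r lerDl ler01//.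
  by lra.
have cA : convex_rV A.
  move=> x y t [Bx /= ux] [By /= uy] t01; split; first exact: box_convex.
  by rewrite /= dotvDr !dotvZr; case/andP: t01 => ? ?; nra.
have e4 : `|4 * e| = 4 * e by rewrite ger0_norm// mulr_ge0// ltW.
have e401 : 0 < 4 * e <= 1 by rewrite e1 mulr_gt0.
have := @leb_sweep_le _ _ A j 2 (4 * e) (4 * e) kA cA (ler0n _ 2) e401 e4 Ab.
rewrite (_ : 2 * (2 + 1) = 6 :> R); last by ring.
apply: le_trans; apply: le_leb => x [xc]; rewrite ler_norml => /andP[l1 l2]; split.
  exists (x - (4 * e) *: delta_mx 0 j).
    split.
      move=> i; rewrite !mxE eqxx/=; have /andP[? ?] := xc i.
      by case: (i == j); rewrite ?mulr1 ?mulr0 ?subr0; apply/andP; split; lra.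
    rewrite /= dotvBr dotvZr.
    have -> : dotv u (delta_mx 0 j) = 1.
      rewrite /dotv (bigD1 j)//= big1 ?addr0 ?mxE ?eqxx ?mulr1// => i ij.
      by rewrite mxE (negbTE ij) andbF mulr0.
    by lra.
  exists ((4 * e) *: delta_mx 0 j); last by rewrite subrK.
  by exists 1; rewrite ?scale1r// ler01 lexx.
by move=> [_ /=]; lra.
Qed.

End Hyperplanes.

(** * Covering the samples contained in a hyperplane *)

Section DegenerateSamples.
Variables (R : realType) (d : nat).
Local Notation V := 'rV[R]_d.+1.

(** A net of hyperplanes: the largest coordinate of the normal is scaled to 1, the others lie in
    [-1, 1] and the offset in [-(d+1), d+1]. The slab width (d+2)/N adds the errors (d+1)/N of the
    normal and 1/N of the offset. *)
Definition slab_index (N : nat) : finType :=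
  ('I_d.+1 * ({ffun 'I_d -> 'I_(2 * N).+1} * 'I_(2 * d.+1 * N).+1))%type.

Definition slab_net (N : nat) (x : slab_index N) : set V :=
  slab (\row_i (if unlift x.1 i is Some i' then -1 + (x.2.1 i')%:R / N%:R else 1))
    (- d.+1%:R + x.2.2%:R / N%:R) (d.+2%:R / N%:R).

Lemma slab_net_cover (N n : nat) (X : 'I_n.+1 -> V) (u : V) (b : R) : (0 < N)%N ->
  (forall i, unit_cube (X i)) -> u != 0 -> (forall i, dotv u (X i) = b) ->
  exists x : slab_index N, forall i, slab_net x (X i).
Proof.
move=> N0 Xc u0 Xb; have NR : 0 < N%:R :> R by rewrite ltr0n.
pose j := [arg max_(i > ord0) `|u 0 i|]%O.
have umax i : `|u 0 i| <= `|u 0 j|.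
  by rewrite /j; case: arg_maxP => // j' _; apply.
have uj0 : 0 < `|u 0 j|.
  rewrite normr_gt0; apply/eqP => uj; move/eqP: u0; apply; apply/rowP => i.
  by rewrite mxE; apply/eqP; rewrite -normr_le0 (le_trans (umax i))// uj normr0.
pose u' := (u 0 j)^-1 *: u; pose b' := (u 0 j)^-1 * b.
have Xb' i : dotv u' (X i) = b' by rewrite dotvZl Xb.
have u'1 i : `|u' 0 i| <= 1.
  by rewrite mxE normrM normfV mulrC ler_pdivrMr// mul1r.
have u'j : u' 0 j = 1 by rewrite mxE mulVf// -normr_gt0.
have X1 i : \sum_l `|X i 0 l| <= d.+1%:R.
  apply: (@le_trans _ _ (\sum_(l < d.+1) 1)); last by rewrite sumr_const card_ord.
  by apply: ler_sum => l _; have /andP[? ?] := Xc i l; rewrite ger0_norm.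
have bd : `|b'| <= d.+1%:R.
  rewrite -(Xb' ord0) (le_trans (ler_norm_sum _ _ _))// (le_trans _ (X1 ord0))//.
  by apply: ler_sum => l _; rewrite normrM ler_piMl.
have /fin_all_exists[f Hf] (i' : 'I_d) :
    exists k : 'I_(2 * N).+1, `|-1 + k%:R / N%:R - u' 0 (lift j i')| <= N%:R^-1.
  have := u'1 (lift j i'); rewrite ler_norml => /andP[? ?].
  by apply: grid_approx => //; rewrite natrM ler_pM2r//; lra.
have [g Hg] : exists k : 'I_(2 * d.+1 * N).+1,
    `|- d.+1%:R + k%:R / N%:R - b'| <= N%:R^-1.
  move: bd; rewrite ler_norml => /andP[b1 b2]; apply: grid_approx => //.
  by rewrite !natrM ler_pM2r//; move: (d.+1%:R) b1 b2 => D b1 b2; lra.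
exists (j, ([ffun i' => f i'], g)) => i; split; first exact: Xc.
set v := \row_ _ _; rewrite /=.
have vu l : `|v 0 l - u' 0 l| <= N%:R^-1.
  rewrite mxE /=; case: unliftP => [i' ->|->]; first by rewrite ffunE.
  by rewrite u'j subrr normr0 invr_ge0 ltW.
have := dotv_near (X i) vu; rewrite !(dotvC (X i)) Xb' => h1.
have h2 : (\sum_l `|X i 0 l|) * N%:R^-1 <= d.+1%:R / N%:R.
  by rewrite ler_pM2r ?invr_gt0.
have -> : d.+2%:R / N%:R = d.+1%:R / N%:R + N%:R^-1 :> R.
  by rewrite -[d.+2%:R]natr1 mulrDl mul1r.
have := le_trans h1 h2; move: Hg; move: (d.+1%:R / N%:R) (- d.+1%:R + _).
move: (N%:R^-1) (dotv v (X i)) => nn D1 D2 c; rewrite !ler_norml.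
by move=> /andP[? ?] /andP[? ?]; apply/andP; split; lra.
Qed.

(** About N^(d+1) slabs of measure O(1/N) each catch n points; since n >= d+2, N^(d+1-n) <= 1/N. *)
Lemma leb_slab_net (N n : nat) (a : R) : 0 <= a -> (4 * d.+2 <= N)%N -> (d.+2 <= n)%N ->
  (leb [set z : 'rV[R]_(n * d.+1 + 1) | (exists x : slab_index N, forall i, slab_net x (sample_of z i))
      /\ (0 <= height_of z <= a)%R]
   <= (d.+1%:R * 3 ^+ d * (3 * d.+1%:R) * (8 * 6 ^+ d.+1 * d.+2%:R) ^+ n * a / N%:R)%:E)%E.
Proof.
move=> a0 dN dn.
have N0 : (0 < N)%N by rewrite (leq_trans _ dN).
have NR : 1 <= N%:R :> R by rewrite ler1n.
have NR0 : 0 < N%:R :> R by rewrite ltr0n.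
set K2 : R := 8 * 6 ^+ d.+1 * d.+2%:R.
have K20 : 0 <= K2 by rewrite !mulr_ge0// exprn_ge0.
have slabK x : (leb (@slab_net N x) <= (K2 / N%:R)%:E)%E.
  rewrite (_ : K2 / N%:R = 2 * 6 ^+ d.+1 * (4 * (d.+2%:R / N%:R))); last first.
    by rewrite /K2; move: (d.+2%:R) => D; field; rewrite gt_eqF.
  apply: (leb_slab (j := x.1)).
  - by rewrite mxE unlift_none.
  - by rewrite divr_gt0.
  - by rewrite mulrA ler_pdivrMr// mul1r -natrM ler_nat.
apply: (@le_trans _ _ (\sum_(x : slab_index N) ((K2 / N%:R) ^+ n * a)%:E)%E).
  pose F (x : slab_index N) := [set z : 'rV[R]_(n * d.+1 + 1) |
    (forall i, slab_net x (sample_of z i)) /\ (0 <= height_of z <= a)%R].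
  apply: (@le_trans _ _ (\sum_x leb (F x))%E).
    apply: le_trans (leb_fin_bigcup _ _); last by rewrite addn1.
    by apply: le_leb => z [[x xz] hz]; exists x.
  by apply: lee_sum => x _; apply: leb_sample_le.
rewrite sumEFin lee_fin sumr_const -[leLHS]mulr_natl.
have cardT : #|{: slab_index N}|%:R <= d.+1%:R * 3 ^+ d * (3 * d.+1%:R) * N%:R ^+ d.+1 :> R.
  rewrite !card_prod card_ffun !card_ord.
  have -> : d.+1%:R * 3 ^+ d * (3 * d.+1%:R) * N%:R ^+ d.+1 =
     (d.+1 * ((3 * N) ^ d * (3 * d.+1 * N)))%:R :> R.
    by rewrite !natrM natrX natrM exprMn exprS; ring.
  rewrite ler_nat leq_mul2l leq_mul//; last by nia.
  by case: (d) => // e; rewrite leq_exp2r//; lia.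
have [e ne] : exists e, n = (d.+2 + e)%N by exists (n - d.+2)%N; rewrite subnKC.
apply: (le_trans (ler_wpM2r _ cardT)).
  by rewrite mulr_ge0// exprn_ge0// divr_ge0// ltW.
set K1 := d.+1%:R * 3 ^+ d * _.
have K10 : 0 <= K1 by rewrite !mulr_ge0// exprn_ge0.
rewrite expr_div_n.
have -> : K1 * N%:R ^+ d.+1 * (K2 ^+ n / N%:R ^+ n * a) =
    K1 * K2 ^+ n * a / N%:R * (N%:R ^+ e)^-1.
  rewrite [X in _ / N%:R ^+ X]ne exprD (exprS _ d.+1) invfM invfM.
  have Nd0 : N%:R ^+ d.+1 != 0 :> R by rewrite expf_neq0// gt_eqF.
  have Ne0 : N%:R ^+ e != 0 :> R by rewrite expf_neq0// gt_eqF.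
  have Nn0 : N%:R != 0 :> R by rewrite gt_eqF.
  move: (K2 ^+ n) (N%:R) (N%:R ^+ d.+1) (N%:R ^+ e) Nd0 Ne0 Nn0 => s r p q p0 q0 r0.
  by field; rewrite p0 q0 r0.
rewrite ler_piMr ?invf_le1 ?exprn_ege1 ?exprn_gt0//.
by rewrite divr_ge0 ?(ltW NR0)// !mulr_ge0// exprn_ge0.
Qed.

Lemma degenerate_in_slab_net (N n : nat) (P : set V) (X : 'I_n -> V) : (0 < N)%N -> (0 < n)%N ->
  P `<=` @unit_cube R d.+1 -> (0 < leb P)%E -> (forall i, P (X i)) ->
  leb (conv_hull (range X)) = 0 -> exists x : slab_index N, forall i, slab_net x (X i).
Proof.
case: n X => // n X N0 _ Pc P0 PX X0.
have [[u [u0 [b ub]]]|[c [t [t0 Bz]]]] := hyperplane_or_box X.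
  by apply: (slab_net_cover N0 _ u0 ub) => i; exact: Pc.
by have := leb_small_box_gt0 c Pc P0 t0; rewrite ltNge -X0 le_leb.
Qed.

(** The height is unbounded here because nothing is known of the estimator on such samples; the set
    is cut at integer heights, and N tends to infinity in each piece. *)
Lemma degenerate_samples_null (n : nat) (P : set V) : (d.+2 <= n)%N ->
  P `<=` @unit_cube R d.+1 -> (0 < leb P)%E ->
  leb [set z : 'rV[R]_(n * d.+1 + 1) | (forall i, P (sample_of z i)) /\
     leb (conv_hull (range (sample_of z))) = 0 /\ (0 <= height_of z)%R] = 0.
Proof.
move=> dn Pc P0.
pose G (a : nat) := [set z : 'rV[R]_(n * d.+1 + 1) | (forall i, P (sample_of z i)) /\
     leb (conv_hull (range (sample_of z))) = 0 /\ (0 <= height_of z <= a%:R)%R].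
suff G0 a : leb (G a) = 0.
  apply/eqP; rewrite eq_le leb_ge0 andbT.
  apply: (@le_trans _ _ (\sum_(0 <= a <oo) leb (G a))%E).
    apply: le_trans (leb_sigma_subadditive _); apply: le_leb => z [Pz [z0 hz]].
    exists (Num.truncn (height_of z)).+1 => //; split => //; split => //.
    by rewrite hz/= ltW// truncnS_gt.
  by rewrite eseries0// => i _ _; rewrite G0.
set K : R := d.+1%:R * 3 ^+ d * (3 * d.+1%:R) * (8 * 6 ^+ d.+1 * d.+2%:R) ^+ n * a%:R.
have K0 : 0 <= K by rewrite !mulr_ge0// !exprn_ge0// !mulr_ge0// exprn_ge0.
have GK N : (4 * d.+2 <= N)%N -> (leb (G a) <= (K / N%:R)%:E)%E.
  move=> dN; apply: le_trans (leb_slab_net (ler0n R a) dN dn).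
  apply: le_leb => z [Pz [z0 hz]]; split => //.
  apply: (degenerate_in_slab_net _ _ Pc P0 Pz z0); first by rewrite (leq_trans _ dN).
  by rewrite (leq_trans _ dn).
have Gfin : leb (G a) \is a fin_num.
  rewrite ge0_fin_numE ?leb_ge0//.
  by apply: (le_lt_trans (GK _ (leqnn _))); rewrite ltry.
apply/eqP; rewrite eq_le leb_ge0 andbT -(fineK Gfin) lee_fin.
rewrite leNgt; apply/negP => g0; set g := fine _ in g0.
pose N := (4 * d.+2 + (Num.truncn (K / g)).+1)%N.
have := GK N (leq_addr _ _); rewrite -(fineK Gfin) lee_fin -/g.
have NR : 0 < N%:R :> R by rewrite ltr0n /N addnS.
rewrite ler_pdivlMr// mulrC -ler_pdivlMr//.
have : K / g < N%:R.
  by apply: lt_le_trans (truncnS_gt _) _; rewrite ler_nat leq_addl.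
by move=> /lt_le_trans h /h; rewrite ltxx.
Qed.

End DegenerateSamples.

(** * Polytopes that contain the sample but miss much of the support *)

Section PolytopeNet.
Variables (R : realType) (d n r : nat) (P : set 'rV[R]_d.+1) (k a : R).
Hypotheses (n2 : (2 <= n)%N) (r0 : (0 < r)%N) (a0 : 0 <= a).
Hypotheses (Pc : P `<=` @unit_cube R d.+1) (hk : 2 * d.+1%:R + 4 <= k).
Local Notation p := (fine (leb P)).
Local Notation grid := {ffun 'I_r * 'I_d.+1 -> 'I_n.+1}.

Definition misses_mass (X : 'I_n -> 'rV[R]_d.+1) : Prop :=
  exists v : 'M[R]_(r, d.+1), [/\ (forall i j, 0 <= v i j <= 1),
    (forall i, hull_mx v (X i)) &
    ((k * r%:R * ln n%:R / n%:R)%:E < leb (P `\` hull_mx v))%E].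

Let vg (f : grid) : 'M[R]_(r, d.+1) := \matrix_(i, j) ((f (i, j))%:R / n%:R).
(** [tau / n] is the missed volume left after rounding the vertices, which costs a thickening by
    2/n. *)
Let tau := k * r%:R * ln n%:R - 2 * cube_lip R d.
Let A f := P `&` thicken (hull_mx (vg f)) n%:R^-1.

Let n0 : 0 < n%:R :> R. Proof. by rewrite ltr0n (leq_trans _ n2). Qed.

Let p0 : 0 <= p. Proof. by rewrite fine_ge0 ?leb_ge0. Qed.

Lemma misses_mass_net X : (forall i, P (X i)) -> misses_mass X ->
  exists f : grid, (forall i, A f (X i)) /\ (leb (A f) <= (p * expR (- (tau / n%:R)))%:E)%E.
Proof.
move=> PX [v [v01 Xv vP]].
have /fin_all_exists[f Hf] (ij : 'I_r * 'I_d.+1) :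
    exists l : 'I_n.+1, `|0 + l%:R / n%:R - v ij.1 ij.2| <= n%:R^-1.
  have /andP[? ?] := v01 ij.1 ij.2; apply: grid_approx => //; first exact: ltnW.
  by rewrite subr0 ler_piMl// ltW.
pose F : grid := [ffun ij => f ij].
have vF i j : `|vg F i j - v i j| <= n%:R^-1.
  by have := Hf (i, j); rewrite add0r !mxE ffunE.
have hsub : hull_mx v `<=` thicken (hull_mx (vg F)) n%:R^-1.
  by apply: hull_mx_thicken => i j; rewrite distrC.
exists F; split; first by move=> i; split; [exact: PX|exact/hsub/Xv].
have ksub : thicken (hull_mx (vg F)) n%:R^-1 `<=` thicken (hull_mx v) (2 / n%:R).
  move=> x [y /(hull_mx_thicken vF)[y' vy' yy'] xy]; exists y' => // i.
  rewrite -(subrKA (y 0 i)) (le_trans (ler_normD _ _))//.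
  by rewrite mulr_natl mulr2n lerD.
have cA : closed (thicken (hull_mx (vg F)) n%:R^-1).
  by apply: compact_closed_rV; apply: thicken_compact; exact: hull_mx_compact.
have dvd : (leb (P `\` hull_mx v) <= leb (P `\` thicken (hull_mx (vg F)) n%:R^-1)
     + (cube_lip R d * (2 / n%:R))%:E)%E.
  have th : (leb (thicken (hull_mx v) (2 / n%:R) `\` hull_mx v)
      <= (cube_lip R d * (2 / n%:R))%:E)%E.
    apply: leb_thicken_diff_cube; [exact: hull_mx_compact|exact: hull_mx_convex| |].
      exact: hull_mx_cube.
    by rewrite divr_gt0//= ler_pdivrMr// mul1r ler_nat.
  apply: le_trans (leeD2l _ th).
  apply: le_trans (lebU _ _ _) => //; apply: le_leb => x [Px nvx].
  have [Tx|nTx] := pselect (thicken (hull_mx (vg F)) n%:R^-1 x); [right|by left].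
  by split => //; exact: ksub.
have Afin : leb (A F) \is a fin_num by apply: leb_subcube_fin => x [/Pc].
have Dfin : leb (P `\` thicken (hull_mx (vg F)) n%:R^-1) \is a fin_num.
  by apply: leb_subcube_fin => x [/Pc].
have pE : p = fine (leb (A F)) + fine (leb (P `\` thicken (hull_mx (vg F)) n%:R^-1)).
  by rewrite (leb_closed_split P cA) fineD.
have p1 : p <= 1.
  rewrite -lee_fin fineK ?leb_subcube_fin//.
  exact: le_trans (le_leb Pc) (unit_cube_leb _ _).
rewrite -(fineK Afin) lee_fin.
have := lt_le_trans vP dvd; rewrite -(fineK Dfin) -EFinD lte_fin => h.
have D0 : 0 <= fine (leb (P `\` thicken (hull_mx (vg F)) n%:R^-1)) by rewrite fine_ge0 ?leb_ge0.
have tn : tau / n%:R = k * r%:R * ln n%:R / n%:R - cube_lip R d * (2 / n%:R).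
  by rewrite /tau; field; rewrite gt_eqF.
(* For tau >= 0, p <= 1 gives p - tau/n <= p (1 - tau/n) <= p exp(-tau/n); for tau < 0 the
   exponential exceeds 1. *)
have [t0|t0] := leP 0 (tau / n%:R).
  have := expR_ge1Dx (- (tau / n%:R)) => /(ler_wpM2l p0); apply: le_trans.
  by move: tn t0 => -> t0; nra.
have : 1 <= expR (- (tau / n%:R)).
  by have := ler_expR (0 : R) (- (tau / n%:R)); rewrite expR0 => ->; rewrite oppr_ge0 ltW.
move=> /(ler_wpM2l p0); rewrite mulr1 => h2; rewrite (le_trans _ h2)//; lra.
Qed.

(** There are (n+1)^(r(d+1)) <= n^(2r(d+1)) grid polytopes, while exp(-tau) is n^(-kr) up to a
    constant; [hk] leaves n^(-4r) <= n^-4. The factor p^n is the normalisation of the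
    expectation. *)
Lemma leb_misses_mass :
  (leb [set z : 'rV[R]_(n * d.+1 + 1) | (forall i, P (sample_of z i)) /\
     misses_mass (sample_of z) /\ (0 <= height_of z <= a)%R]
   <= (expR (2 * cube_lip R d) * n%:R ^- 4 * p ^+ n * a)%:E)%E.
Proof.
pose q := p * expR (- (tau / n%:R)).
have q0 : 0 <= q by rewrite mulr_ge0// expR_ge0.
pose B f := [set z : 'rV[R]_(n * d.+1 + 1) | (forall i, A f (sample_of z i)) /\
   (leb (A f) <= q%:E)%E /\ (0 <= height_of z <= a)%R].
apply: (@le_trans _ _ (\sum_f leb (B f))%E).
  apply: le_trans (leb_fin_bigcup _ _); last by rewrite addn1.
  apply: le_leb => z [Pz [/(misses_mass_net Pz)[f [Af qA]] hz]].
  by exists f.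
apply: (@le_trans _ _ (\sum_(f : grid) (q ^+ n * a)%:E)%E).
  apply: lee_sum => f _; have [qA|nqA] := pselect (leb (A f) <= q%:E)%E.
    apply: le_trans (leb_sample_le _ a0 qA); apply: le_leb => z [Az [_ hz]].
    by split.
  rewrite (_ : B f = set0) ?leb0 ?addn1// ?lee_fin ?mulr_ge0 ?exprn_ge0//.
  by apply/seteqP; split => // z [_ []].
rewrite sumEFin lee_fin sumr_const -[leLHS]mulr_natl card_ffun card_prod !card_ord.
rewrite /q exprMn -expRM_natl.
have lnn : 0 <= ln n%:R :> R by rewrite ln_ge0// ler1n ltnW.
have netE : (n.+1 ^ (r * d.+1))%:R <= expR (2 * (r * d.+1)%:R * ln n%:R) :> R.
  rewrite natrX -mulrA mulrCA expRM_natl lerXn2r ?nnegrE ?expR_ge0//.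
  by rewrite mulrC expRM_natr lnK ?posrE// -natrX ler_nat; nia.
have E : (n.+1 ^ (r * d.+1))%:R * expR (n%:R * - (tau / n%:R)) <=
    expR (2 * cube_lip R d) * n%:R ^- 4.
  apply: (le_trans (ler_wpM2r (expR_ge0 _) netE)).
  rewrite -expRD (_ : n%:R ^- 4 = expR (- (4 * ln n%:R))); last first.
    by rewrite expRN mulrC expRM_natr lnK.
  rewrite -expRD ler_expR (_ : n%:R * _ = - tau); last by field; rewrite gt_eqF.
  rewrite /tau natrM.
  have rR : 1 <= r%:R :> R by rewrite ler1n.
  have h1 : 4 * ln n%:R <= (k - 2 * d.+1%:R) * r%:R * ln n%:R :> R.
    rewrite ler_wpM2r//; move: (d.+1%:R) hk rR => D hk' rR; nra.
  move: h1; move: (d.+1%:R) => D h1; lra.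
have pa : 0 <= p ^+ n * a by rewrite mulr_ge0// exprn_ge0.
apply: le_trans (le_trans _ (ler_wpM2r pa E)) _;
  by rewrite le_eqVlt; apply/orP; left; apply/eqP; ring.
Qed.

End PolytopeNet.

(** * Symmetric differences and volume comparison *)

Section SymmetricDifference.
Variables (R : realType) (d : nat).
Local Notation V := 'rV[R]_d.+1.
Implicit Types A B W : set V.

Lemma leb_symdiff_triangle A W B :
  (leb (symdiff A B) <= leb (symdiff A W) + leb (symdiff W B))%E.
Proof.
apply: le_trans (lebU _ _ _) => //; apply: le_leb => x.
by have [Wx|nWx] := pselect (W x); move=> [[Ax nBx]|[Bx nAx]];
  [right; left|left; right|left; left|right; right].
Qed.

Lemma leb_symdiff_le A B : (leb (symdiff A B) <= leb (A `\` B) + leb (B `\` A))%E.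
Proof. exact: lebU. Qed.

Lemma symdiffC A B : symdiff A B = symdiff B A.
Proof. by rewrite /symdiff setUC. Qed.

Lemma leb_symdiff_cube A B : A `<=` @unit_cube R d.+1 -> B `<=` @unit_cube R d.+1 ->
  (leb (symdiff A B) <= 1%:E)%E.
Proof.
move=> Ac Bc; apply: le_trans (unit_cube_leb _ _); apply: le_leb => x.
by move=> [[/Ac]|[/Bc]].
Qed.

(** |A \ B| = |A| - |A & B| <= |W| - |B| + |B \ A|. Here [A] is a minimizer, [B] the support and [W]
    a competitor around it; W = B is the polytope case. *)
Lemma leb_setD_le A B W : closed A -> closed B -> B `<=` W -> W `<=` @unit_cube R d.+1 ->
  (leb A <= leb W)%E -> (leb (A `\` B) <= leb (B `\` A) + leb (W `\` B))%E.
Proof.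
move=> cA cB BW Wc AW; have Bc : B `<=` @unit_cube R d.+1 by move=> x /BW /Wc.
have Wfin := leb_subcube_fin Wc; have Bfin := leb_subcube_fin Bc.
have sub (S S' : set V) : leb S \is a fin_num -> S' `<=` S -> leb S' \is a fin_num.
  move=> Sfin S'S; rewrite ge0_fin_numE ?leb_ge0// (le_lt_trans (le_leb S'S))//.
  by rewrite -ge0_fin_numE ?leb_ge0.
have Afin : leb A \is a fin_num.
  by rewrite ge0_fin_numE ?leb_ge0// (le_lt_trans AW)// -ge0_fin_numE ?leb_ge0.
have := leb_closed_split A cB; have := leb_closed_split B cA; have := leb_closed_split W cB.
have -> : W `&` B = B by apply/setIidPr.
rewrite (setIC B A); move: AW.
have F1 := sub _ _ Afin (@subIsetl _ A B); have F2 := sub _ _ Afin (@subDsetl _ A B).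
have F3 := sub _ _ Bfin (@subDsetl _ B A); have F4 := sub _ _ Wfin (@subDsetl _ W B).
rewrite -(fineK Wfin) -(fineK Bfin) -(fineK Afin) -(fineK F1) -(fineK F2) -(fineK F3) -(fineK F4).
rewrite -!EFinD !lee_fin => AW [W1] [B1] [A1].
by move: W1 B1 A1 AW => -> -> ->; lra.
Qed.

End SymmetricDifference.

(** * The selected number of vertices *)

Section SelectedIndex.
Variables (R : realType) (d n : nat) (C : R).
Variable Phat : nat -> ('I_n -> 'rV[R]_d) -> set 'rV[R]_d.
Variable X : 'I_n -> 'rV[R]_d.
Hypotheses (dn : (d < n)%N).

Definition admissible (r : nat) : Prop := forall r', (r <= r' <= n)%N ->
  (leb (symdiff (Phat r X) (Phat r' X)) <= (C * r'%:R * ln n%:R / n%:R)%:E)%E.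

Lemma rhat_le r : (d < r <= n)%N -> admissible r -> (rhat C Phat X <= r)%N.
Proof.
move=> /andP[dr rn] ar; rewrite /rhat; set s := seq.filter _ _.
have rs : r \in s by rewrite mem_filter; apply/andP; split; [exact/asboolP|rewrite mem_iota; lia].
have ss : sorted ltn s by apply: sorted_filter (iota_ltn_sorted _ _); exact: ltn_trans.
case: s rs ss => // x s; rewrite inE => /orP[/eqP ->//|rs] /=.
by move=> /(order_path_min ltn_trans)/allP/(_ _ rs)/ltnW.
Qed.

(** Admissibility of [n] makes the filtered list nonempty, so [head] returns a member of it and not
    its default. *)
Lemma rhat_admissible : admissible n -> (d < rhat C Phat X <= n)%N /\ admissible (rhat C Phat X).
Proof.
move=> an; rewrite {1 2}/rhat; set s := seq.filter _ _.
have ns : n \in s.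
  by rewrite mem_filter; apply/andP; split; [exact/asboolP|rewrite mem_iota; lia].
have hs : head n s \in s by case: s ns => // x s _; rewrite mem_head.
move: (hs); rewrite mem_filter mem_iota => /andP[/asboolP h /andP[h1 h2]].
by split; [lia|exact: h].
Qed.

End SelectedIndex.

Section Rates.
Variable R : realType.

Lemma ln_ge_half (n : nat) : (2 <= n)%N -> 1 / 2 <= ln n%:R :> R.
Proof.
move=> n2; have n2R : 2 <= n%:R :> R by rewrite ler_nat.
have n0 : 0 < n%:R :> R by lra.
have V2 : n%:R^-1 <= 1 / 2 :> R by rewrite div1r lef_pV2 ?posrE.
have V0 : 0 < n%:R^-1 :> R by rewrite invr_gt0.
have h : -1 < n%:R^-1 - 1 :> R by lra.
have := le_ln1Dx h; rewrite addrC subrK lnV ?posrE//; lra.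
Qed.

(** With w = n^(1/(d+2)) in dimension d+1, the real exponents of the threshold and of the rate
    become natural powers of w. *)
Lemma powR_root (n d : nat) : (1 <= n)%N -> exists w : R, [/\ 1 <= w, n%:R = w ^+ d.+2,
  powR n%:R (d%:R / d.+2%:R) = w ^+ d & powR n%:R (- (2%:R / d.+2%:R)) = (w ^+ 2)^-1].
Proof.
move=> n1; have nR : 1 <= n%:R :> R by rewrite ler1n.
have n0 : 0 <= n%:R :> R by rewrite ler0n.
have d0 : d.+2%:R != 0 :> R by rewrite pnatr_eq0.
exists (powR n%:R d.+2%:R^-1).
have wX k : powR (n%:R : R) (d.+2%:R^-1 * k%:R) = powR n%:R d.+2%:R^-1 ^+ k.
  by rewrite powRrM powR_mulrn// powR_ge0.
split.
- have : powR (1 : R) d.+2%:R^-1 <= powR n%:R d.+2%:R^-1.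
    by apply: ge0_ler_powR; rewrite ?nnegrE ?invr_ge0.
  by rewrite powR1.
- by rewrite -wX mulVf// powRr1.
- by rewrite -wX mulrC.
- by rewrite powRN -wX mulrC.
Qed.

End Rates.

(** * The risk of the adaptive estimator *)

Section DeterministicBounds.
Variables (R : realType) (d n : nat) (C : R).
Variable Phat : nat -> ('I_n -> 'rV[R]_d.+1) -> set 'rV[R]_d.+1.
Variables (P : set 'rV[R]_d.+1) (X : 'I_n -> 'rV[R]_d.+1).
Hypotheses (dn : (d.+2 <= n)%N) (C0 : 0 <= C).
Hypothesis HPhat : estimator_choice Phat.
Hypotheses (Pc : P `<=` @unit_cube R d.+1) (kP : compact P) (cP : convex_rV P).
Hypotheses (PX : forall i, P (X i)) (X0 : (0 < leb (conv_hull (range X)))%E).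
Hypothesis good : forall r, (0 < r <= n)%N -> ~ misses_mass r P (C / 4) X.

Let n0 : (0 < n)%N. Proof. exact: leq_trans dn. Qed.
Let nR : 0 < n%:R :> R. Proof. by rewrite ltr0n. Qed.
Let lnn : 0 <= ln n%:R :> R. Proof. by rewrite ln_ge0// ler1n. Qed.

Let Kn := conv_hull (range X).

Lemma sample_hull_mx : Kn = hull_mx (\matrix_i X i).
Proof.
rewrite -conv_hull_mx /Kn; congr conv_hull.
by apply: eq_imagel => i _; rewrite rowK.
Qed.

Lemma sample_hull_sub : Kn `<=` P.
Proof. by rewrite sample_hull_mx; apply: hull_mx_min => // i; rewrite rowK. Qed.

Lemma Phat_min r (v0 : 'M[R]_(r, d.+1)) : (d.+1 < r <= n)%N ->
  (forall i j, 0 <= v0 i j <= 1) -> (forall i, hull_mx v0 (X i)) ->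
  is_min_poly r X (Phat r X).
Proof.
move=> rn v001 Xv0; apply: HPhat => //.
have r0 : (0 < r)%N by case/andP: rn => dr _; exact: leq_trans dr.
exact: is_min_poly_exists r0 v001 Xv0 X0.
Qed.

Lemma Phat_n_min : is_min_poly n X (Phat n X).
Proof.
apply: (@Phat_min n (\matrix_i X i)); first by rewrite dn leqnn.
  by move=> i j; rewrite mxE; exact: (Pc (PX i) j).
by move=> i; have := row_hull_mx (\matrix_i X i) i; rewrite rowK.
Qed.

Lemma min_poly_hull r Q : (0 < r)%N -> is_min_poly r X Q ->
  exists2 v : 'M[R]_(r, d.+1), (forall i j, 0 <= v i j <= 1) & Q = hull_mx v.
Proof. by move=> r0 [/(Pclass_mxP _ r0)[]]. Qed.

Lemma min_poly_closed r Q : (0 < r)%N -> is_min_poly r X Q -> closed Q.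
Proof.
move=> r0 /(min_poly_hull r0)[v _ ->].
by apply: compact_closed_rV; exact: hull_mx_compact.
Qed.

Lemma min_poly_mass r Q : (0 < r <= n)%N -> is_min_poly r X Q ->
  (leb (P `\` Q) <= (C / 4 * r%:R * ln n%:R / n%:R)%:E)%E.
Proof.
move=> /[dup] rn /andP[r0 _] /[dup] [[_ QX _]] /(min_poly_hull r0)[v v01 QE].
rewrite leNgt; apply/negP => h; apply: (good rn); exists v; split=> //.
  by rewrite -QE.
by rewrite -QE.
Qed.

Lemma selected_admissible :
  (d.+1 < rhat C Phat X <= n)%N /\ admissible C Phat X (rhat C Phat X).
Proof.
apply: rhat_admissible => // r' nr'n.
have -> : r' = n by apply/eqP; rewrite eqn_leq andbC.
rewrite /symdiff setDv setU0 leb0// lee_fin.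
by rewrite !(divr_ge0, mulr_ge0)// ltW.
Qed.

Lemma Padapt_crude : (leb (symdiff (Padapt C Phat X) P) <= (C * ln n%:R + 1)%:E)%E.
Proof.
have [/andP[_ hn] ha] := selected_admissible.
rewrite /Padapt; case: ifP => _; last first.
  apply: (@le_trans _ _ 1%:E).
    by apply: leb_symdiff_cube => //; apply: subset_trans Pc; exact: sample_hull_sub.
  by rewrite lee_fin lerDr mulr_ge0.
apply: le_trans (leb_symdiff_triangle _ (Phat n X) _) _; rewrite EFinD; apply: leeD.
  have := ha n; rewrite hn leqnn => /(_ isT); rewrite (_ : C * n%:R * _ / _ = C * ln n%:R)//.
  by field; rewrite gt_eqF.
have [v v01 ->] := min_poly_hull n0 Phat_n_min.
by apply: leb_symdiff_cube => //; exact: hull_mx_cube.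
Qed.

(** The factor 3/2 is C for the selected set against [Phat r X], plus 2 C/4 for [Phat r X] against
    [P]. *)
Lemma Padapt_polytope r : (d.+1 < r <= n)%N -> Pclass (Some r) P -> r%:Z <= Rn (R := R) d.+1 n ->
  (leb (symdiff (Padapt C Phat X) P) <= (3 / 2 * C * r%:R * ln n%:R / n%:R)%:E)%E.
Proof.
move=> /[dup] drn /andP[dr rn] hP rR.
have r0 : (0 < r)%N by exact: leq_trans dr.
have cPc := compact_closed_rV kP.
pose t (q : nat) : R := C / 4 * q%:R * ln n%:R / n%:R.
have tt (q q' : nat) : (q <= q')%N -> t q <= t q'.
  move=> qq; rewrite /t !ler_wpM2r ?invr_ge0 ?(ltW nR)//.
  by rewrite ler_wpM2l ?ler_nat// divr_ge0.
have Pmin r' : (r <= r' <= n)%N -> (leb (symdiff (Phat r' X) P) <= (2 * t r')%:E)%E.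
  move=> /andP[rr' r'n]; have r'0 := leq_trans r0 rr'.
  have hP' : Pclass (Some r') P.
    case: hP => h1 h2 [s [sr Ps]]; split => //; exists s; split => //.
    exact: leq_trans rr'.
  have [P0 [v v01 PE]] := (Pclass_mxP _ r'0).1 hP'.
  have Qmin : is_min_poly r' X (Phat r' X).
    apply: (Phat_min (v0 := v)) => //; first by rewrite (leq_trans dr).
    by rewrite -PE.
  have [_ _ /(_ P hP' PX) QP] := Qmin.
  have h1 : (leb (P `\` Phat r' X) <= (t r')%:E)%E.
    by apply: min_poly_mass => //; rewrite r'0.
  apply: le_trans (leb_symdiff_le _ _) _.
  rewrite mulr2n mulrDl mul1r EFinD leeD//.
  apply: le_trans (leb_setD_le (min_poly_closed r'0 Qmin) cPc (fun _ => id) Pc QP) _.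
  by rewrite setDv leb0// adde0.
have adm : admissible C Phat X r.
  move=> r' /[dup] rr'n /andP[rr' r'n].
  apply: le_trans (leb_symdiff_triangle _ P _) _.
  rewrite (symdiffC P); apply: (le_trans (leeD (Pmin r _) (Pmin r' rr'n))).
    by rewrite leqnn.
  rewrite -EFinD lee_fin (_ : C * r'%:R * _ / _ = 4 * t r'); last by rewrite /t; field; rewrite gt_eqF.
  by have := tt _ _ rr'; lra.
have hr : (rhat C Phat X <= r)%N by apply: rhat_le.
have [_ ha] := selected_admissible.
rewrite /Padapt (le_trans _ rR) ?lez_nat//.
apply: le_trans (leb_symdiff_triangle _ (Phat r X) _) _.
apply: (le_trans (leeD (ha r _) (Pmin r _))); rewrite ?hr ?leqnn//.
rewrite -EFinD lee_fin /t le_eqVlt; apply/orP; left; apply/eqP.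
by field; rewrite gt_eqF.
Qed.

(** The bound on [Rn] makes a selected index below the threshold at most r, so its admissibility can
    be tested against [Phat r X], whose competitor is a polytope enclosing [P]. *)
Lemma Padapt_convex m : (0 < m)%N -> (outer_const d * m ^ d <= n)%N ->
  Rn (R := R) d.+1 n <= (outer_const d * m ^ d)%N%:Z ->
  (leb (symdiff (Padapt C Phat X) P) <=
     (3 / 2 * C * (outer_const d * m ^ d)%:R * ln n%:R / n%:R
       + cube_lip R d * (m%:R ^+ 2)^-1)%:E)%E.
Proof.
move=> m0; set r := (outer_const d * m ^ d)%N => rn Rr.
have dr : (d.+1 < r)%N.
  have m1 : (1 <= m ^ d)%N by rewrite expn_gt0 m0.
  have h3 : (3 <= 3 ^ d.+1)%N by rewrite -{1}(expn1 3) leq_exp2l.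
  have h6 : (1 <= (6 * d.+1) ^ d)%N by rewrite expn_gt0.
  have h2 : (1 <= 2 ^ d.+1)%N by rewrite expn_gt0.
  rewrite /r /outer_const; move: (m ^ d)%N (3 ^ d.+1)%N ((6 * d.+1) ^ d)%N (2 ^ d.+1)%N m1 h3 h6 h2.
  move=> a b c e a1 b3 c1 e1; nia.
have r0 : (0 < r)%N by exact: leq_trans dr.
have mR : 1 <= m%:R :> R by rewrite ler1n.
have mV : 0 < ((m%:R : R) ^+ 2)^-1 <= 1.
  by rewrite invr_gt0 exprn_gt0 ?ltr0n//= invf_le1 ?exprn_gt0 ?ltr0n// exprn_ege1.
have L0 : 0 <= cube_lip R d * (m%:R ^+ 2)^-1.
  by rewrite !mulr_ge0 ?exprn_ge0 ?ler0n ?invr_ge0 ?exprn_ge0//.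
have approx (K : set 'rV[R]_d.+1) : compact K -> convex_rV K -> K `<=` P ->
    (forall i, K (X i)) -> exists W : set 'rV[R]_d.+1, [/\ K `<=` W, W `<=` @unit_cube R d.+1,
      (leb (W `\` K) <= (cube_lip R d * (m%:R ^+ 2)^-1)%:E)%E,
      Pclass (Some r) W &
      is_min_poly r X (Phat r X) /\ (leb (P `\` W) <= (C / 4 * r%:R * ln n%:R / n%:R)%:E)%E].
  move=> kK cK KP KX.
  have Kc : K `<=` @unit_cube R d.+1 by apply: subset_trans Pc.
  have K0 : K !=set0 by exists (X (Ordinal n0)).
  have [r' [v [/andP[r'0 r'r] v01 Kv vK]]] := outer_approx kK cK K0 Kc m0.
  have vX i : hull_mx v (X i) by apply: Kv.
  have W0 : (0 < leb (hull_mx v))%E.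
    apply: lt_le_trans X0 _; apply: le_leb; rewrite -/Kn sample_hull_mx.
    by apply: hull_mx_min => [|i]; [exact: hull_mx_convex|rewrite rowK].
  have Wr' : Pclass (Some r') (hull_mx v) by apply/(Pclass_mxP _ r'0); split => //; exists v.
  have Wr : Pclass (Some r) (hull_mx v).
    case: Wr' => h1 h2 [s [sr Ps]]; split => //; exists s; split => //.
    exact: leq_trans r'r.
  have [_ [w w01 wE]] := (Pclass_mxP _ r0).1 Wr.
  exists (hull_mx v); split => //; first exact: hull_mx_cube.
  - apply: le_trans (leb_thicken_diff_cube kK cK Kc mV); apply: le_leb.
    by apply: setSD.
  - split; first by apply: (Phat_min (v0 := w)); rewrite -?wE ?dr.
    rewrite leNgt; apply/negP => h; have rn' : (0 < r <= n)%N by rewrite r0.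
    by apply: (good rn'); exists w; split => //; rewrite -wE.
have rn' : (0 < r <= n)%N by rewrite r0.
have [_ ha] := selected_admissible.
rewrite /Padapt; case: ifP => hR.
  have [W [PW Wc WP Wr [Qmin _]]] := approx P kP cP (fun _ => id) PX.
  have [_ _ /(_ W Wr (fun i => PW _ (PX i))) QW] := Qmin.
  have h1 := min_poly_mass rn' Qmin.
  have h2 := leb_setD_le (min_poly_closed r0 Qmin) (compact_closed_rV kP) PW Wc QW.
  have hr : (rhat C Phat X <= r <= n)%N.
    by rewrite rn andbT -lez_nat (le_trans hR).
  apply: le_trans (leb_symdiff_triangle _ (Phat r X) _) _.
  apply: (le_trans (leeD (ha r hr) (leb_symdiff_le _ _))).
  apply: (le_trans (leeD (lexx _) (leeD (le_trans h2 (leeD h1 WP)) h1))).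
  rewrite -!EFinD lee_fin le_eqVlt; apply/orP; left; apply/eqP.
  move: ((m%:R ^+ 2)^-1) (n%:R) nR => mm N NR; by field; rewrite gt_eqF.
have kK : compact Kn by rewrite sample_hull_mx; exact: hull_mx_compact.
have cK : convex_rV Kn by rewrite sample_hull_mx; exact: hull_mx_convex.
have XK i : Kn (X i).
  by rewrite sample_hull_mx; have := row_hull_mx (\matrix_i X i) i; rewrite rowK.
(* The hull of the sample may have too many vertices for the mass bound at r; its enclosing polytope
   has at most r and is only slightly larger. *)
have [W [KW Wc WK Wr [_ PW]]] := approx Kn kK cK sample_hull_sub XK.
apply: (@le_trans _ _ (leb (P `\` W) + leb (W `\` Kn))%E).
  apply: le_trans (lebU _ _ _) => //; apply: le_leb => x [[/sample_hull_sub]//|[Px nKx]].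
  by have [Wx|nWx] := pselect (W x); [right|left].
apply: (le_trans (leeD PW WK)); rewrite -EFinD lee_fin lerD2r.
have CC : C / 4 <= 3 / 2 * C.
  rewrite ler_pdivrMr// (_ : 3 / 2 * C * 4 = 6 * C); last by field.
  by rewrite ler_peMl// ler1n.
by do 3!apply: ler_wpM2r => //; rewrite invr_ge0 ltW.
Qed.

End DeterministicBounds.

Section Risk.
Variables (R : realType) (d : nat) (C : R).
Hypothesis C0 : 0 <= C.

Lemma Pclass_convex_body (r : option nat) (P : set 'rV[R]_d.+1) :
  (if r is Some r0 then (d.+2 <= r0)%N else true) -> Pclass r P ->
  [/\ P `<=` @unit_cube R d.+1, (0 < leb P)%E, compact P & convex_rV P].
Proof.
case: r => [r|] hr hP; last first.
  case: hP => Pc P0 [kP cP]; split => // x y t Px Py /andP[t0 t1].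
  by have /set_mem := cP x y (Itv01 t0 t1) (mem_set Px) (mem_set Py).
have r0 : (0 < r)%N by exact: leq_trans hr.
have [P0 [v v01 PE]] := (Pclass_mxP _ r0).1 hP; split=> //.
- by case: hP.
- by rewrite PE; exact: hull_mx_compact.
- by rewrite PE; exact: hull_mx_convex.
Qed.

(** One group of terms per case: polytopes below the threshold, convex bodies, and n smaller than
    the vertex budget. [A * w^d] bounds that budget, 2^d coming from m <= 2w. *)
Definition rate_const : R :=
  let A := (outer_const d)%:R * 2 ^+ d in
  3 / 2 * C + 3 / 2 * C * A + 2 * cube_lip R d + (C + 2) * A.

Lemma phi_ge (n : nat) (r : option nat) : (2 <= n)%N ->
  (if r is Some r0 then (d.+2 <= r0)%N else true) ->
  ln n%:R / n%:R <= phi d.+1 n r :> R.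
Proof.
move=> n2 hr.
have [w [w1 nw _ yw]] := powR_root R d (ltnW n2).
have lnn : 0 <= ln n%:R :> R by rewrite (le_trans _ (ln_ge_half R n2)).
have w0 : 0 < w by exact: lt_le_trans w1.
have h : ln n%:R / n%:R <= ln n%:R * powR n%:R (- (2%:R / d.+2%:R)) :> R.
  rewrite yw [X in _ / X]nw; apply: ler_wpM2l => //.
  by rewrite lef_pV2 ?posrE ?exprn_gt0// ler_weXn2l.
rewrite /phi; case: r hr => [r|] hr //.
rewrite le_min h andbT -mulrA ler_peMl ?divr_ge0//.
by rewrite ler1n (leq_trans _ hr).
Qed.

Lemma Padapt_crude_phi (n : nat) (r : option nat) : (2 <= n)%N ->
  (if r is Some r0 then (d.+2 <= r0)%N else true) ->
  C * ln n%:R + 1 <= (C + 2) * n%:R * phi d.+1 n r.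
Proof.
move=> n2 hr; have h1 := ln_ge_half R n2; have h2 := phi_ge n2 hr.
have nR : 0 < n%:R :> R by rewrite ltr0n ltnW.
move: h2; rewrite ler_pdivrMr// => h2.
have : (C + 2) * ln n%:R <= (C + 2) * (phi d.+1 n r * n%:R).
  by rewrite ler_wpM2l// addr_ge0.
rewrite (_ : (C + 2) * (_ * _) = (C + 2) * n%:R * phi d.+1 n r); last by ring.
by apply: le_trans; lra.
Qed.

Lemma Padapt_good (n : nat) (Phat : nat -> ('I_n -> 'rV[R]_d.+1) -> set 'rV[R]_d.+1)
    (r : option nat) (P : set 'rV[R]_d.+1) (X : 'I_n -> 'rV[R]_d.+1) :
  (d.+2 <= n)%N -> estimator_choice Phat ->
  (if r is Some r0 then (d.+2 <= r0)%N else true) -> Pclass r P ->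
  (forall i, P (X i)) -> (0 < leb (conv_hull (range X)))%E ->
  (forall q, (0 < q <= n)%N -> ~ misses_mass q P (C / 4) X) ->
  (leb (symdiff (Padapt C Phat X) P) <= (rate_const * phi d.+1 n r)%:E)%E.
Proof.
move=> dn HPhat hr hP PX X0 good.
have [Pc P0 kP cP] := Pclass_convex_body hr hP.
have n2 : (2 <= n)%N by exact: leq_trans dn.
have lnn := ln_ge_half R n2.
have ln0 : 0 <= ln n%:R :> R by rewrite (le_trans _ lnn).
have [w [w1 nw xw yw]] := powR_root R d (ltnW n2).
have w0 : 0 < w by exact: lt_le_trans w1.
have nR : 0 < n%:R :> R by rewrite ltr0n ltnW.
have RnE (q : nat) : (q%:Z <= Rn (R := R) d.+1 n) = (q%:R <= w ^+ d).
  by rewrite /Rn floor_ge_int /= xw.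
set A : R := (outer_const d)%:R * 2 ^+ d.
have A0 : 0 <= A by rewrite mulr_ge0// exprn_ge0.
have L0 : 0 <= cube_lip R d by rewrite !mulr_ge0// exprn_ge0// mulr_ge0.
have CA : 0 <= C * A by rewrite mulr_ge0.
set rate := ln n%:R * (w ^+ 2)^-1.
have rate0 : 0 <= rate by rewrite mulr_ge0// invr_ge0 exprn_ge0// ltW.
have ratio : w ^+ d * ln n%:R / n%:R = rate.
  rewrite /rate [X in _ / X]nw -addn2 exprD.
  by field; rewrite !expf_neq0 gt_eqF.
(* By [ratio] the two arguments of the minimum in [phi] cross at r = w^d, whose floor is [Rn].
   Beyond it [P] counts only as a convex body. *)
have [[q [rE qR]]|big] : (exists q, r = Some q /\ q%:R <= w ^+ d) \/ phi d.+1 n r = rate.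
  rewrite /phi /= yw -/rate; case: r {hr hP} => [q|]; last by right.
  have [qw|wq] := leP q%:R (w ^+ d); first by left; exists q.
  right; apply: min_r; rewrite -ratio !ler_wpM2r ?invr_ge0// ltW//.
- subst r; have qn : (q <= n)%N.
    rewrite -(ler_nat R) (le_trans qR)// [leRHS]nw; apply: ler_weXn2l => //; exact: leqW.
  have := @Padapt_polytope R d n C Phat P X dn C0 HPhat Pc kP PX X0 good.
  move=> /(_ q); rewrite hr qn => /(_ isT hP); rewrite RnE => /(_ qR) /le_trans; apply.
  have -> : phi d.+1 n (Some q) = q%:R * ln n%:R / n%:R :> R.
    rewrite /phi /= yw; apply: min_l; rewrite -/rate -ratio.
    by do 2!apply: ler_wpM2r => //; rewrite invr_ge0 ltW.
  rewrite lee_fin -/A; set z := _ / n%:R.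
  have z0 : 0 <= q%:R * ln n%:R / n%:R :> R by rewrite divr_ge0 ?mulr_ge0// ltW.
  rewrite (_ : z = 3 / 2 * C * (q%:R * ln n%:R / n%:R)); last by rewrite /z; ring.
  apply: ler_wpM2r => //; rewrite /rate_const -/A.
  have := mulr_ge0 C0 A0; lra.
rewrite big.
pose m := (Num.truncn w).+1.
have wm : w < m%:R by exact: truncnS_gt.
have mw : m%:R <= 2 * w.
  have /andP[h _] := truncn_itv (ltW w0).
  by rewrite /m -natr1; lra.
have mR0 : 0 < m%:R :> R by rewrite ltr0n.
pose q := (outer_const d * m ^ d)%N.
have qA : q%:R <= A * w ^+ d.
  rewrite /q natrM natrX /A -mulrA -exprMn ler_wpM2l//.
  by apply: lerXn2r; rewrite ?nnegrE ?ler0n ?mulr_ge0 ?(ltW w0).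
have oc1 : (1 <= outer_const d)%N by rewrite /outer_const !muln_gt0 !expn_gt0.
have wq : w ^+ d <= q%:R.
  rewrite /q natrM natrX; apply: (@le_trans _ _ (m%:R ^+ d)).
    by apply: lerXn2r; rewrite ?nnegrE ?ler0n ?(ltW w0) ?(ltW wm).
  by rewrite ler_peMl ?exprn_ge0 ?ler1n// ltW.
have [qn|nq] := leqP q n.
  have Rq : Rn (R := R) d.+1 n <= q%:Z.
    rewrite -(ler_int R) (le_trans (floor_le _))//=.
    by rewrite xw.
  apply: (le_trans (@Padapt_convex R d n C Phat P X dn C0 HPhat Pc kP cP PX X0 good m _ qn Rq)) => //.
  rewrite lee_fin.
  have h1 : 3 / 2 * C * q%:R * ln n%:R / n%:R <= 3 / 2 * C * A * rate.
    rewrite -ratio; have -> : 3 / 2 * C * A * (w ^+ d * ln n%:R / n%:R) =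
      3 / 2 * C * (A * w ^+ d) * ln n%:R / n%:R by ring.
    do 2!(apply: ler_wpM2r; first by rewrite ?invr_ge0 ?(ltW nR)).
    by apply: ler_wpM2l => //; rewrite mulr_ge0.
  have h2 : (m%:R ^+ 2)^-1 <= 2 * rate.
    apply: (@le_trans _ _ (w ^+ 2)^-1).
      rewrite lef_pV2 ?posrE ?exprn_gt0//; by apply: lerXn2r; rewrite ?nnegrE ?ler0n ?(ltW w0) ?(ltW wm).
    by rewrite /rate mulrA ler_peMl ?invr_ge0 ?exprn_ge0 ?(ltW w0)//; lra.
  have := ler_wpM2l L0 h2.
  have h3 : 0 <= (3 / 2 * C + (C + 2) * A) * rate.
    by rewrite mulr_ge0// addr_ge0// mulr_ge0// ?addr_ge0// mulr_ge0.
  rewrite /rate_const -/A -/q; move: h1 h3; move: (_ / n%:R) => z; lra.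
(* When the budget q exceeds n, A w^d >= n = w^(d+2) forces A >= w^2: n is bounded by a constant and
   the crude bound suffices. *)
apply: (le_trans (Padapt_crude dn C0 HPhat Pc cP PX X0)).
rewrite lee_fin.
have w2A : 1 <= A * (w ^+ 2)^-1.
  rewrite ler_pdivlMr ?exprn_gt0// mul1r.
  have : w ^+ d * w ^+ 2 <= w ^+ d * A.
    rewrite -exprD addn2 -nw (mulrC _ A) (le_trans _ qA)// ler_nat ltnW//.
  by rewrite ler_pM2l ?exprn_gt0.
have : (C + 2) * ln n%:R <= (C + 2) * A * rate.
  rewrite /rate -mulrA ler_wpM2l ?addr_ge0// mulrCA ler_peMr//.
move=> h4.
have h5 : 0 <= (3 / 2 * C + 3 / 2 * C * A + 2 * cube_lip R d) * rate.
  by rewrite mulr_ge0// !addr_ge0// !mulr_ge0.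
rewrite /rate_const -/A mulrDl; apply: le_trans (_ : (C + 2) * A * rate <= _); last by rewrite lerDr.
by apply: le_trans h4; lra.
Qed.

(** The subgraph is covered by good samples with height at most [rate_const], n exceptional events
    with height at most (C + 2) n, and a null set. The exceptional part contributes n * n^-4 * n =
    n^-2 times constants. *)
Lemma outer_expect_le (n : nat) (Phat : nat -> ('I_n -> 'rV[R]_d.+1) -> set 'rV[R]_d.+1)
    (r : option nat) (P : set 'rV[R]_d.+1) :
  2 * d.+1%:R + 4 <= C / 4 -> (d.+2 <= n)%N -> estimator_choice Phat ->
  (if r is Some r0 then (d.+2 <= r0)%N else true) -> Pclass r P ->
  (outer_expect P (fun X : 'I_n -> 'rV[R]_d.+1 =>
     ((phi d.+1 n r)^-1)%:E * leb (symdiff (Padapt C Phat X) P))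
   <= (rate_const + expR (2 * cube_lip R d) * (C + 2))%:E)%E.
Proof.
move=> hk dn HPhat hr hP.
have [Pc P0 kP cP] := Pclass_convex_body hr hP.
have n2 : (2 <= n)%N by exact: leq_trans dn.
have nR : 0 < n%:R :> R by rewrite ltr0n ltnW.
have phi0 : 0 < phi d.+1 n r :> R.
  apply: lt_le_trans (phi_ge n2 hr); rewrite divr_gt0//.
  by rewrite (lt_le_trans _ (ln_ge_half R n2)).
have L0 : 0 <= cube_lip R d by rewrite !mulr_ge0// exprn_ge0// mulr_ge0.
have rc0 : 0 <= rate_const.
  by rewrite /rate_const !addr_ge0// !mulr_ge0// ?addr_ge0 ?exprn_ge0.
set p := fine (leb P).
have Pfin := leb_subcube_fin Pc.
have p0 : 0 < p by rewrite fine_gt0// P0 -ge0_fin_numE// leb_ge0.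
pose T : R := (C + 2) * n%:R.
have T0 : 0 <= T by rewrite mulr_ge0 ?addr_ge0// ltW.
pose E : R := expR (2 * cube_lip R d).
pose S1 := [set z : 'rV[R]_(n * d.+1 + 1) | (forall i, P (sample_of z i)) /\
  (0 <= height_of z <= rate_const)%R].
pose S2 (q : 'I_n) := [set z : 'rV[R]_(n * d.+1 + 1) | (forall i, P (sample_of z i)) /\
  misses_mass q.+1 P (C / 4) (sample_of z) /\ (0 <= height_of z <= T)%R].
pose S3 := [set z : 'rV[R]_(n * d.+1 + 1) | (forall i, P (sample_of z i)) /\
  leb (conv_hull (range (sample_of z))) = 0 /\ (0 <= height_of z)%R].
have height_le (B h : R) (x : \bar R) : (x <= (B * phi d.+1 n r)%:E)%E ->
    (h%:E < ((phi d.+1 n r)^-1)%:E * x)%E -> h <= B.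
  move=> xB hx; rewrite -lee_fin (le_trans (ltW hx))//.
  apply: le_trans (lee_wpmul2l _ xB) _; first by rewrite lee_fin invr_ge0 ltW.
  by rewrite -EFinM lee_fin mulrCA mulVf ?mulr1// gt_eqF.
rewrite /outer_expect -/p; set S := [set z | _].
have SS : S `<=` S1 `|` ((\bigcup_q S2 q) `|` S3).
  move=> z [Pz [h0 hz]].
  have [X00|X0] := eqVneq (leb (conv_hull (range (sample_of z)))) 0; first by right; right.
  have {}X0 : (0 < leb (conv_hull (range (sample_of z))))%E.
    by rewrite lt_neqAle leb_ge0 andbT eq_sym.
  have [good|/existsNP[q /not_implyP[/andP[q0 qn] /contrapT bad]]] :=
      pselect (forall q, (0 < q <= n)%N -> ~ misses_mass q P (C / 4) (sample_of z)).
    left; split => //; rewrite h0; apply: (height_le _ _ _ _ hz).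
    exact: Padapt_good.
  right; left; case: q q0 qn bad => // q _ qn bad; exists (Ordinal qn) => //.
  split => //; split => //; rewrite h0; apply: (height_le _ _ _ _ hz).
  apply: le_trans (Padapt_crude dn C0 HPhat Pc cP Pz X0) _.
  by rewrite lee_fin; exact: Padapt_crude_phi.
have pn0 : 0 < p ^+ n by rewrite exprn_gt0.
have B1 : (leb S1 <= (p ^+ n * rate_const)%:E)%E.
  by apply: leb_sample_le => //; rewrite fineK.
have B2 : (leb (\bigcup_q S2 q) <= (p ^+ n * (E * (C + 2)))%:E)%E.
  apply: le_trans (leb_fin_bigcup _ _) _; first by rewrite addn1.
  apply: (@le_trans _ _ (\sum_(q < n) (E * n%:R ^- 4 * p ^+ n * T)%:E)%E).
    by apply: lee_sum => q _; exact: leb_misses_mass.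
  rewrite sumEFin lee_fin sumr_const card_ord -[leLHS]mulr_natl.
  have -> : n%:R * (E * n%:R ^- 4 * p ^+ n * T) = p ^+ n * (E * (C + 2)) * (n%:R ^+ 2)^-1.
    by rewrite /T; move: (p ^+ n) n%:R nR => pn N NR; field; rewrite gt_eqF.
  rewrite ler_piMr ?mulr_ge0 ?addr_ge0 ?expR_ge0 ?(ltW pn0)//.
  by rewrite invf_le1 ?exprn_gt0// exprn_ege1// ler1n ltnW.
have B3 : leb S3 = 0 by exact: degenerate_samples_null.
have SB : (leb S <= (p ^+ n * (rate_const + E * (C + 2)))%:E)%E.
  apply: le_trans (le_leb SS) _.
  apply: le_trans (lebU _ _ _) _; first by rewrite addn1.
  rewrite mulrDr EFinD leeD//.
  apply: le_trans (lebU _ _ _) _; first by rewrite addn1.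
  by rewrite B3 adde0.
apply: (@le_trans _ _ ((p ^+ n * (rate_const + E * (C + 2)))%:E * (p ^- n)%:E)%E).
  by apply: lee_wpmul2r => //; rewrite lee_fin invr_ge0 ltW.
by rewrite -EFinM lee_fin mulrAC mulfV ?mul1r// gt_eqF.
Qed.

End Risk.

Theorem theorem5 (R : realType) (d : nat) (C : R) :
  (2 <= d)%N ->
  16 * d%:R + 16 / d.+1%:R < C ->
  exists c : R, 0 < c /\
    forall (n : nat) (Phat : nat -> ('I_n -> 'rV[R]_d) -> set 'rV[R]_d),
      (d.+1 <= n)%N ->
      estimator_choice Phat ->
      forall (r : option nat) (P : set 'rV[R]_d),
        (if r is Some r0 then (d.+1 <= r0)%N else true) ->
        Pclass r P ->
        (outer_expect P (fun X =>
           ((phi d n r)^-1)%:E * leb (symdiff (Padapt C Phat X) P)) <= c%:E)%E.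
Proof.
case: d => // d d1 hC.
have dR : 2 <= d.+1%:R :> R by rewrite ler_nat.
have V0 : 0 < 16 / d.+2%:R :> R by rewrite divr_gt0.
(* C / 4 exceeds four times the dimension, and 4D >= 2D + 4 for D >= 2. *)
have hk : 2 * d.+1%:R + 4 <= C / 4.
  by move: (d.+1%:R) (16 / d.+2%:R) hC dR V0 => D v hC dR V0; lra.
have C0 : 0 <= C by move: (d.+1%:R) hk dR => D hk dR; lra.
have L0 : 0 <= cube_lip R d by rewrite !mulr_ge0// exprn_ge0// mulr_ge0.
have rc0 : 0 <= rate_const d C.
  by rewrite /rate_const !addr_ge0// !mulr_ge0// ?addr_ge0 ?exprn_ge0.
exists (rate_const d C + expR (2 * cube_lip R d) * (C + 2)); split.
  by rewrite ltr_wpDl// mulr_gt0 ?expR_gt0// ltr_wpDl.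
move=> n Phat dn HPhat r P hr hP; exact: outer_expect_le.
Qed.
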